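(* Let $q>1$ be real and let $(a_n)_{n\ge1}$ be a sequence of positive integers with $a_{n+1}\ge q\,a_n$ for all $n\ge1$. Suppose in addition that $a_n\mid a_{n+1}$ for every $n\ge1$. Then, for Lebesgue-almost every $x\in\mathbb{T}$, $$\lim_{N\to\infty}\frac{N\,G_N(x)}{\log N}=1.$$
   Context: $\mathbb{T}=\mathbb{R}/\mathbb{Z}$ with Lebesgue (Haar probability) measure. An interval in $\mathbb{T}$ is a circular arc, and $|J|$ denotes its length. For $x\in\mathbb{T}$ and $N\ge1$ put $A_N(x)=\{a_1x,\ldots,a_Nx\}\subset\mathbb{T}$ and define the maximal circular gap $$G_N(x)=\sup\{|J|:\ J\subset\mathbb{T}\text{ is an interval and }J\cap A_N(x)=\varnothing\}.$$ *)

(* Defs.v *)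
From HB Require Import structures.
From mathcomp Require Import all_boot all_order all_algebra.
From mathcomp Require Import all_classical all_reals all_analysis.

Set Implicit Arguments.
Unset Strict Implicit.
Unset Printing Implicit Defensive.

Import Order.TTheory GRing.Theory Num.Theory.
Import numFieldNormedType.Exports.

Local Open Scope classical_set_scope.
Local Open Scope ring_scope.

(* The additive group R/Z: [Num.int_num_subdef] is the predicate underlying
   [Num.int], to which the library attaches the subgroup structure. *)
Definition circle (R : realType) :=
  Quotient.quot (GRing.ZmodClosed.clone R (@Num.int_num_subdef R) _).

Lemma circle_eqP (R : realType) (s t : R) :
  reflect ((\pi_(circle R) s)%qT = (\pi_(circle R) t)%qT) (s - t \is a Num.int).
Proof. by rewrite [X in reflect _ X]Quotient.idealrBE; exact: eqP. Qed.

HB.instance Definition _ (R : realType) := GRing.Zmodule.on (circle R).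
HB.instance Definition _ (R : realType) := isPointed.Build (circle R) 0.

Definition circle_pi (R : realType) (t : R) : circle R :=
  (\pi_(circle R) t)%qT.

Definition circle_display : measure_display.
Proof. exact: default_measure_display. Qed.

(* B is measurable iff its preimage in R is (Borel) measurable. *)
Definition circle_measurable (R : realType) : set (set (circle R)) :=
  image_set_system [set: R] (@circle_pi R) measurable.

Lemma circle_measurable_sigma (R : realType) :
  sigma_algebra [set: circle R] (@circle_measurable R).
Proof. by apply: sigma_algebra_image; exact: sigma_algebra_measurable. Qed.

Section circle_measurable_structure.
Variable R : realType.

Let cmeas0 : @circle_measurable R set0.
Proof. by case: (circle_measurable_sigma R). Qed.

Let cmeasC (A : set (circle R)) :
  circle_measurable A -> circle_measurable (~` A).
Proof.
by case: (circle_measurable_sigma R) => _ h _ /h; rewrite setTD.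
Qed.

Let cmeasU (F : (set (circle R))^nat) :
  (forall i, circle_measurable (F i)) -> circle_measurable (\bigcup_i F i).
Proof. by case: (circle_measurable_sigma R) => _ _; exact. Qed.

HB.instance Definition _ :=
  isMeasurable.Build circle_display (circle R) cmeas0 cmeasC cmeasU.

End circle_measurable_structure.

Lemma measurable_circle_pi (R : realType) :
  measurable_fun [set: R] (@circle_pi R).
Proof. by move=> _ B mB. Qed.

HB.instance Definition _ (R : realType) :=
  isMeasurableFun.Build _ _ _ _ (@circle_pi R) (@measurable_circle_pi R).

(* Lebesgue measure on the fundamental domain [0, 1[, pushed to R/Z. *)
Definition circle_measure (R : realType) : set (circle R) -> \bar R :=
  pushforward
    (mrestr (@lebesgue_measure R) (measurable_itv `[0 : R, 1 : R[))
    (@circle_pi R).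

Section circle_measure_instance.
Variable R : realType.
Local Open Scope ereal_scope.

Let cmu0 : @circle_measure R set0 = 0.
Proof. by rewrite /circle_measure /pushforward preimage_set0 measure0. Qed.

Let cmu_ge0 (B : set (circle R)) : 0 <= circle_measure B.
Proof. exact: measure_ge0. Qed.

Let cmu_sigma_additive : semi_sigma_additive (@circle_measure R).
Proof.
move=> F mF tF mUF; rewrite /circle_measure /pushforward preimage_bigcup.
apply: measure_semi_sigma_additive.
- by move=> i; rewrite -[X in measurable X]setTI; exact: measurable_circle_pi.
- apply/trivIsetP => /= i j _ _ ij; rewrite -preimage_setI.
  by move/trivIsetP : tF => /(_ _ _ _ _ ij) ->//; rewrite preimage_set0.
- rewrite -preimage_bigcup -[X in measurable X]setTI.
  exact: measurable_circle_pi.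
Qed.

HB.instance Definition _ := isMeasure.Build _ _ _ (@circle_measure R)
  cmu0 cmu_ge0 cmu_sigma_additive.

End circle_measure_instance.

Lemma circle_measure_setT (R : realType) :
  @circle_measure R [set: circle R] = 1%E.
Proof.
rewrite /circle_measure /pushforward /mrestr preimage_setT setTI.
by rewrite lebesgue_measure_itv /= lte_fin ltr01 oppr0 adde0.
Qed.

HB.instance Definition _ (R : realType) :=
  Measure_isProbability.Build _ _ _ (@circle_measure R)
    (@circle_measure_setT R).

(* Circular arcs are the images in R/Z of the intervals of R; this includes the
   empty arc, points, and the whole circle. *)
Definition is_arc (R : realType) (J : set (circle R)) : Prop :=
  exists2 I : set R, is_interval I & J = (@circle_pi R) @` I.

Definition arc_length (R : realType) (J : set (circle R)) : R :=
  fine (circle_measure J).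

(* A_N(x) = {a_1 x, ..., a_N x}; the term a 0 is never used. *)
Definition orbit_set (R : realType) (a : nat -> nat) (N : nat)
    (x : circle R) : set (circle R) :=
  [set x *+ a n | n in [set n : nat | (1 <= n <= N)%N]].

Definition max_gap (R : realType) (a : nat -> nat) (N : nat)
    (x : circle R) : R :=
  sup [set arc_length J | J in
         [set J : set (circle R) | is_arc J /\ J `&` orbit_set a N x = set0]].

(* Main.v *)
Require Import Defs.
From mathcomp Require Import all_boot all_order all_algebra.
From mathcomp Require Import all_classical all_reals all_analysis.
From mathcomp Require Import measurable_realfun.
From mathcomp Require Import ring lra zify.

Import Order.TTheory GRing.Theory Num.Theory.
Import numFieldNormedType.Exports.

Local Open Scope classical_set_scope.
Local Open Scope ring_scope.

Set Implicit Arguments.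
Unset Strict Implicit.
Unset Printing Implicit Defensive.

(** Write [x] in the mixed radix given by the chain [a 1 | a 2 | ...]. The point
    [a n * x] of the circle is determined, up to a small error, by a short window
    of digits starting at place [n], and the digits are independent and uniform.
    The orbit therefore behaves like independent uniform points, for which the
    maximal gap is asymptotically [ln N / N]: an arc of length [c * ln N / N] is
    missed by [N] points with probability about [N ^- c], and there are about [N]
    arcs to consider. All probabilities are computed as averages over finite digit
    strings ([avg], [avg_divmod]), which [digits_event] transfers to the circle.

    The digits are cut into blocks. A point is truncated at the end of its block,
    so that the hits of an interval in different blocks are independent events.

    Upper bound. A second moment computation ([block_hit_ge]) shows that a block of
    [M] points hits an interval of length [L] with probability nearly [M * L],
    unless the interval is close to a fixed point of a map [y |-> s * y] with a
    small integer [s], where hits cluster. By independence an interval is missed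
    with probability nearly [exp (- N * L)]. Near the fixed points one keeps only
    one point out of [kap], which still gives a negative power of [N]; this is
    enough since only [O(ln N)] intervals of the grid are concerned
    ([sum_not_good_le]). A union bound over a grid then gives [upper_scale].

    Lower bound. Take disjoint cells of length [(1 - eps) * ln N / N]. In each block
    every cell is hit with probability at most [M * L], and a block of [M] points
    hits at most [M] cells; the exponential moment of the number of missed cells
    hence obeys a recursion over the blocks ([avg_exp_survivors_le]), and a power
    of [N] of cells is missed except with tiny probability. The points close to the
    end of a block depend on two blocks. They are few, and for each of them all
    other blocks are still independent of it ([avg_unhit_straddle_le]): by Markov's
    inequality they hit only a small part of the missed cells. This gives
    [lower_scale].

    Both bounds fail at [N = k ^ d] with probability [O(k ^- 2)]. Borel-Cantelli
    ([ae_eventually]) and the monotonicity of the maximal gap in [N] conclude. *)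

(** * Finite averages *)

Section Average.
Variable R : realFieldType.
Implicit Types (f g : nat -> R) (x y : R).

Definition avg (n : nat) f : R := (\sum_(0 <= i < n) f i) / n%:R.

Lemma le_avg n f g :
  (forall i, (i < n)%N -> f i <= g i) -> avg n f <= avg n g.
Proof.
move=> fg; rewrite ler_wpM2r ?invr_ge0 ?ler0n//.
by rewrite !big_mkord; apply: ler_sum => i _; exact: fg.
Qed.

Lemma eq_avg n f g : (forall i, (i < n)%N -> f i = g i) -> avg n f = avg n g.
Proof.
move=> fg; rewrite /avg !big_mkord; congr (_ / _).
by apply: eq_bigr => i _; exact: fg.
Qed.

Lemma avgD n f g : avg n (fun i => f i + g i) = avg n f + avg n g.
Proof. by rewrite /avg big_split /= mulrDl. Qed.

Lemma avgN n f : avg n (fun i => - f i) = - avg n f.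
Proof. by rewrite /avg sumrN mulNr. Qed.

Lemma avgZ n x f : avg n (fun i => x * f i) = x * avg n f.
Proof. by rewrite /avg -mulr_sumr mulrA. Qed.

Lemma avgZr n x f : avg n (fun i => f i * x) = avg n f * x.
Proof. by rewrite mulrC -avgZ; apply: eq_avg => i _; rewrite mulrC. Qed.

Lemma avg_sum n (I : Type) (r : seq I) (P : pred I) (F : I -> nat -> R) :
  avg n (fun i => \sum_(j <- r | P j) F j i) = \sum_(j <- r | P j) avg n (F j).
Proof. by rewrite /avg exchange_big /= mulr_suml. Qed.

Lemma avg_cst n x : (0 < n)%N -> avg n (fun=> x) = x.
Proof.
move=> n0; rewrite /avg sumr_const_nat subn0 -[x *+ n]mulr_natr mulfK//.
by rewrite pnatr_eq0 -lt0n.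
Qed.

Lemma avg_ge0 n f : (forall i, (i < n)%N -> 0 <= f i) -> 0 <= avg n f.
Proof.
move=> f0; rewrite mulr_ge0 ?invr_ge0 ?ler0n//.
by rewrite big_mkord; apply: sumr_ge0 => i _; exact: f0.
Qed.

Lemma sum_divmod s t (F : nat -> nat -> R) : (0 < t)%N ->
  \sum_(0 <= k < s * t) F (k %/ t)%N (k %% t)%N =
  \sum_(0 <= u < s) \sum_(0 <= v < t) F u v.
Proof.
move=> t0; elim: s => [|s IHs]; first by rewrite mul0n !big_geq.
rewrite big_nat_recr //= -IHs mulSnr (big_cat_nat _ (n := s * t)) ?leq_addr//=.
congr (_ + _); rewrite -{1}[(s * t)%N]add0n big_addn addKn.
apply: eq_big_nat => v /andP[_ vt].
by rewrite addnC divnMDl// modnMDl divn_small// modn_small// addn0.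
Qed.

(** The two digits [k %/ t] and [k %% t] of a uniform [k < s * t] are
    independent and uniform; all independence used below comes from here. *)
Lemma avg_divmod s t (F : nat -> nat -> R) : (0 < t)%N ->
  avg (s * t) (fun k => F (k %/ t)%N (k %% t)%N) =
  avg s (fun u => avg t (F u)).
Proof.
by move=> t0; rewrite /avg sum_divmod// -mulr_suml natrM invfM mulrA mulrAC.
Qed.

Lemma avg_mod n t f : (0 < n)%N -> (t %| n)%N ->
  avg n (fun k => f (k %% t)%N) = avg t f.
Proof.
move=> n0 /dvdnP[s ns]; move: n0; rewrite ns muln_gt0 => /andP[s0 t0].
by rewrite (avg_divmod s (fun _ => f))// avg_cst.
Qed.

(** A half-open interval of length [y - x] contains [y - x] integers up to an
    error of at most one. *)
Lemma sum_itv_le n x y : x <= y ->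
  \sum_(0 <= j < n) (x <= j%:R < y)%R%:R <= y - x + 1.
Proof.
move=> xy.
suff : \sum_(0 <= j < n) (x <= j%:R < y)%R%:R <=
       Num.max 0 (Num.min n%:R (y + 1) - x) :> R.
  move=> /le_trans; apply; rewrite ge_max; apply/andP; split; first lra.
  have : Num.min n%:R (y + 1) <= y + 1 by rewrite ge_min lexx orbT.
  lra.
elim: n => [|n IHn]; first by rewrite big_geq// le_max lexx.
rewrite big_nat_recr//= -natr1.
move: IHn; case: (ltP n%:R y) => ny; case: (leP x n%:R) => xn /=;
  rewrite /Num.max /Num.min; do !case: ifP => //; lra.
Qed.

Lemma sum_itv_ge n x y : 0 <= x -> y <= n%:R ->
  y - x - 1 <= \sum_(0 <= j < n) (x <= j%:R < y)%R%:R.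
Proof.
move=> x0 yn.
suff : Num.min n%:R y - x - 1 <= \sum_(0 <= j < n) (x <= j%:R < y)%R%:R.
  by rewrite min_r.
elim: n {yn} => [|n IHn].
  rewrite big_geq//; have : Num.min 0 y <= 0 by rewrite ge_min lexx.
  lra.
rewrite big_nat_recr//= -natr1.
have S0 : 0 <= \sum_(0 <= j < n) (x <= j%:R < y)%R%:R :> R.
  by apply: sumr_ge0 => *; rewrite ler0n.
move: S0 IHn; case: (ltP n%:R y) => ny; case: (leP x n%:R) => xn /=;
  rewrite /Num.min; do !case: ifP => //; lra.
Qed.

End Average.

(** * How often a block of points hits an interval *)

Section Hit.
Variable R : realFieldType.
Implicit Types (al be : R) (t Q v : nat).

Lemma avg_exchange s t (F : nat -> nat -> R) :
  avg s (fun u => avg t (F u)) = avg t (fun v => avg s (F^~ v)).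
Proof. by rewrite /avg -!mulr_suml exchange_big /= mulrAC. Qed.

(** [(v %% t) / t] is the point [{a_n x}] truncated to the resolution [1 / t],
    when [v] collects the digits of [x] up to that resolution. *)
Definition hit al be t v : bool :=
  (al * t%:R <= (v %% t)%:R < be * t%:R)%R.

Lemma hit_mod al be t Q v : (t %| Q)%N -> hit al be t (v %% Q) = hit al be t v.
Proof. by move=> tQ; rewrite /hit modn_dvdm. Qed.

Lemma avg_hit al be t Q : (0 < Q)%N -> (t %| Q)%N ->
  avg Q (fun v => (hit al be t v)%:R) =
  (\sum_(0 <= j < t) (al * t%:R <= j%:R < be * t%:R)%R%:R) / t%:R :> R.
Proof.
move=> Q0 tQ.
rewrite (avg_mod (fun v => (al * t%:R <= v%:R < be * t%:R)%R%:R) Q0 tQ).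
by [].
Qed.

Lemma avg_hit_le al be t Q : (0 < Q)%N -> (t %| Q)%N -> al <= be ->
  avg Q (fun v => (hit al be t v)%:R) <= be - al + t%:R^-1.
Proof.
move=> Q0 tQ ab; have t0 : 0 < t%:R :> R by rewrite ltr0n (dvdn_gt0 Q0).
rewrite avg_hit// ler_pdivrMr// mulrDl mulVf ?gt_eqF// mulrBl.
by apply: sum_itv_le; rewrite ler_pM2r.
Qed.

Lemma avg_hit_ge al be t Q : (0 < Q)%N -> (t %| Q)%N -> 0 <= al -> be <= 1 ->
  be - al - t%:R^-1 <= avg Q (fun v => (hit al be t v)%:R).
Proof.
move=> Q0 tQ a0 b1; have t0 : 0 < t%:R :> R by rewrite ltr0n (dvdn_gt0 Q0).
rewrite avg_hit// ler_pdivlMr// 2!mulrBl mulVf ?gt_eqF//.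
by apply: sum_itv_ge; [rewrite mulr_ge0// ltW | rewrite ler_piMl// ltW].
Qed.

(** Two points of the orbit with frequency ratio [s = t / t'] are nearly
    independent up to the resolution [1 / s]: once the later one is known, the
    earlier one is uniform in a translate of [Z / s]. *)
Lemma avg_hit2 al be t t' Q :
    (0 < Q)%N -> (t %| Q)%N -> (t' %| t)%N -> al <= be ->
  avg Q (fun v => (hit al be t v && hit al be t' v)%:R) <=
  (be - al + t'%:R / t%:R) * (be - al + t'%:R^-1).
Proof.
move=> Q0 tQ /dvdnP[s tE] ab.
have := dvdn_gt0 Q0 tQ; rewrite tE muln_gt0 => /andP[s0 t0].
have s0' : 0 < s%:R :> R by rewrite ltr0n.
have t0' : 0 < t'%:R :> R by rewrite ltr0n.
pose F c d : R := (al * (s * t')%:R <= (c * t' + d)%:R < be * (s * t')%:R)%R%:R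
  * (al * t'%:R <= d%:R < be * t'%:R)%R%:R.
rewrite (eq_avg (g := fun v => F ((v %% t) %/ t') ((v %% t) %% t'))%N); last first.
  move=> v _; rewrite /F -divn_eq -natrM mulnb -tE.
  by rewrite /hit modn_dvdm// tE dvdn_mull.
rewrite (avg_mod (fun w => F (w %/ t') (w %% t')))%N// tE avg_divmod//.
rewrite avg_exchange.
apply: (@le_trans _ _ (avg t' (fun d => (be - al + s%:R^-1) *
    (al * t'%:R <= d%:R < be * t'%:R)%R%:R))).
  apply: le_avg => d _; rewrite /F avgZr ler_wpM2r// /avg ler_pdivrMr//.
  rewrite mulrDl mulVf ?gt_eqF// natrM.
  rewrite (eq_bigr (fun c => (s%:R * al - d%:R / t'%:R <= c%:R
      < s%:R * be - d%:R / t'%:R)%R%:R)); last first.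
    move=> c _; rewrite lerBlDr ltrBrDr !natrD !natrM; congr (_ : bool)%:R.
    rewrite -[in RHS](ler_pM2r t0') -[in RHS](ltr_pM2r t0') !mulrDl !mulfVK ?gt_eqF//.
    by rewrite !mulrA ![_ * s%:R]mulrC.
  apply: le_trans (sum_itv_le _ _) _; first by rewrite lerD2r ler_pM2l.
  rewrite le_eqVlt; apply/orP; left; apply/eqP; ring.
have -> : t'%:R / (s * t')%:R = s%:R^-1 :> R.
  by rewrite natrM; field; rewrite ?gt_eqF.
rewrite avgZ ler_wpM2l//.
  by rewrite addr_ge0 ?subr_ge0// invr_ge0 ltW.
rewrite /avg ler_pdivrMr// mulrDl mulVf ?gt_eqF// mulrBl.
by apply: sum_itv_le; rewrite ler_pM2r.
Qed.

(** Bonferroni's inequality, truncated after the pairs. *)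
Lemma has_ge_sum_pairs (P : nat -> bool) M :
  \sum_(0 <= m < M) (P m)%:R
    - \sum_(0 <= m' < M) \sum_(0 <= m < m') (P m && P m')%:R
  <= (has P (iota 0 M))%:R :> R.
Proof.
elim: M => [|M IHM]; first by rewrite !big_geq// subr0.
have -> : has P (iota 0 M.+1) = has P (iota 0 M) || P M.
  by rewrite -addn1 iotaD has_cat/= orbF add0n.
rewrite !big_nat_recr//=.
move: IHM; set X := \sum_(0 <= m < M) _; set Y := \sum_(0 <= m' < M) _.
case: (P M) => /= XY; last first.
  by rewrite orbF [in leLHS]big1 ?addr0// => m _; rewrite andbF.
rewrite orbT; under [X in _ - (_ + X)]eq_bigr do rewrite andbT.
rewrite -/X /=.
have Y0 : 0 <= Y by rewrite /Y; do 2 (apply: sumr_ge0 => ? _).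
lra.
Qed.

(** A sequence that at least doubles at every step has small partial sums, even
    after discarding its terms above a threshold [w]. *)
Lemma sum_doubling_lt (z : nat -> R) w n : 0 <= w ->
    (forall m, (m <= n)%N -> 0 <= z m) ->
    (forall m, (m < n)%N -> 2 * z m <= z m.+1) ->
  \sum_(0 <= m < n) (if z m < w then z m else 0) <= 2 * w.
Proof.
move=> w0; suff H : forall n, (forall m, (m <= n)%N -> 0 <= z m) ->
    (forall m, (m < n)%N -> 2 * z m <= z m.+1) ->
    \sum_(0 <= m < n) (if z m < w then z m else 0) <= 2 * w /\
    \sum_(0 <= m < n) (if z m < w then z m else 0) <= z n.
  by move=> z0 zd; case: (H n).
elim=> [|{}n IHn] z0 zd.
  by rewrite !big_geq//; split; [lra|exact: z0].
have [||] := IHn; [by move=> m mn; apply: z0; lia|by move=> m mn; apply: zd; lia|].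
have := zd n (ltnSn n); have := z0 n (leqnSn n).
by rewrite big_nat_recr//=; case: (ltP (z n) w) => *; lra.
Qed.

(** Second moment bound for a block of points: if returns with frequency ratio
    at most [S] are impossible, the hits of the [M] points are almost disjoint
    events as soon as [M * (be - al)] and [1 / S] are small. *)
Lemma block_hit_ge (t : nat -> nat) (M Q : nat) (S tau al be : R) :
    (0 < Q)%N -> 0 < S -> 0 <= al -> al <= be -> be <= 1 ->
    (forall m, (m < M)%N -> (t m %| Q)%N) ->
    (forall m, (m.+1 < M)%N -> (t m.+1 %| t m)%N) ->
    (forall m, (m.+1 < M)%N -> (2 * t m.+1 <= t m)%N) ->
    (forall m, (m < M)%N -> (t m)%:R^-1 <= tau) ->
    (forall m m' v, (m < m')%N -> (m' < M)%N -> (t m)%:R <= S * (t m')%:R ->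
       hit al be (t m) v -> hit al be (t m') v -> False) ->
  M%:R * (be - al - tau)
    - M%:R * (be - al + tau) * (M%:R * (be - al) + 2 / S)
  <= avg Q (fun v => (has (fun m => hit al be (t m) v) (iota 0 M))%:R).
Proof.
move=> Q0 S0 a0 ab b1 tQ tdvd tdbl ttau sep.
pose L := be - al; have L0 : 0 <= L by rewrite /L; lra.
have t0 m : (m < M)%N -> 0 < (t m)%:R :> R.
  by move=> mM; rewrite ltr0n (dvdn_gt0 Q0)// tQ.
apply: (@le_trans _ _ (avg Q (fun v =>
    \sum_(0 <= m < M) (hit al be (t m) v)%:R
    - \sum_(0 <= m' < M) \sum_(0 <= m < m')
        (hit al be (t m) v && hit al be (t m') v)%:R))); last first.
  by apply: le_avg => v _; exact: has_ge_sum_pairs.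
rewrite avgD avgN !avg_sum; apply: lerB.
  rewrite mulr_natl -[M in leLHS]subn0 -sumr_const_nat !big_mkord.
  apply: ler_sum => m _; apply: le_trans (avg_hit_ge Q0 (tQ _ _) a0 b1) => //.
  by rewrite lerD2l lerN2 ttau.
have tau0 m : (m < M)%N -> 0 <= tau.
  by move=> mM; apply: le_trans (ttau m mM); rewrite invr_ge0 ltW// t0.
have tdvd' m' m : (m <= m')%N -> (m' < M)%N -> (t m' %| t m)%N.
  elim: m' => [|m' IH]; first by rewrite leqn0 => /eqP ->.
  rewrite leq_eqVlt => /predU1P[-> //|mm' m'M].
  by apply: dvdn_trans (tdvd _ m'M) (IH _ _) => //; lia.
rewrite -mulrA mulr_natl -[M in leRHS]subn0 -sumr_const_nat !big_mkord.
apply: ler_sum => m' _; rewrite avg_sum.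
have m'M := ltn_ord m'; set j := nat_of_ord m'.
have tau_ge0 := tau0 _ m'M.
pose z m : R := (t j)%:R / (t m)%:R.
apply: (@le_trans _ _ (\sum_(0 <= m < j)
    (L + (if z m < S^-1 then z m else 0)) * (L + tau))).
  rewrite !big_mkord; apply: ler_sum => m _; have mj := ltn_ord m.
  case: (ltP (z m) S^-1) => zS.
    apply: le_trans (avg_hit2 Q0 (tQ _ _) (tdvd' _ _ _ _) ab) _ => //.
    - exact: ltn_trans mj m'M.
    - exact: ltnW.
    by rewrite ler_wpM2l ?lerD2l ?ttau// addr_ge0// mulr_ge0 ?invr_ge0.
  rewrite (_ : avg _ _ = 0); first by rewrite mulr_ge0//; lra.
  rewrite (eq_avg (g := fun=> 0)) ?avg_cst// => v _.
  case: andP => // -[h h']; exfalso; apply: (sep m j v) => //.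
  have tm0 : 0 < (t m)%:R :> R by apply: t0; exact: ltn_trans mj m'M.
  by move: zS; rewrite /z ler_pdivlMr// mulrC ler_pdivrMr// mulrC.
rewrite -mulr_suml mulrC ler_wpM2l//; first by rewrite addr_ge0.
rewrite big_split/=; apply: lerD.
  rewrite sumr_const_nat subn0 -[L *+ j]mulr_natl ler_wpM2r// ler_nat.
  by rewrite subn0 ltnW.
apply: sum_doubling_lt => [|m mj|m mj]; first by rewrite invr_ge0 ltW.
  by rewrite /z divr_ge0.
have tm0 : 0 < (t m)%:R :> R by apply: t0; lia.
have tm10 : 0 < (t m.+1)%:R :> R by apply: t0; lia.
rewrite /z mulrCA ler_wpM2l// ler_pdivrMr// mulrC ler_pdivlMr// -natrM ler_nat.
by apply: tdbl; lia.
Qed.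

End Hit.

(** * Independent blocks of digits *)

Section Blocks.
Variables (R : realType) (P Q : nat -> nat).
Hypothesis Q_gt0 : forall b, (0 < Q b)%N.
Hypothesis P_gt0 : forall b, (0 < P b)%N.
Hypothesis PS : forall b, P b.+1 = (P b * Q b)%N.

(** [u < P b] encodes the first [b] blocks of digits in mixed radix, and
    [g b v] says that the content [v < Q b] of block [b] produces a hit. *)
Fixpoint unhit (g : nat -> pred nat) (b u : nat) : bool :=
  if b is b'.+1 then unhit g b' (u %/ Q b')%N && ~~ g b' (u %% Q b')%N else true.

(** [gg b] is a hit which is decided by the two consecutive blocks [b], [b.+1]
    together. *)
Fixpoint straddle (gg : nat -> pred nat) (b u : nat) : bool :=
  if b is b'.+1 then
    straddle gg b' (u %/ Q b')%N ||
    (if b' is b''.+1 then gg b'' (u %% (Q b'' * Q b'))%N else false)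
  else false.

Lemma avg_unhit_le (g : nat -> pred nat) (rho : R) B : 0 <= rho ->
    (forall b, (b < B)%N -> avg (Q b) (fun v => (~~ g b v)%:R) <= rho) ->
  avg (P B) (fun u => (unhit g B u)%:R) <= rho ^+ B.
Proof.
move=> rho0; elim: B => [|B IHB] H; first by rewrite expr0 avg_cst.
rewrite PS; pose F u v : R := (unhit g B u)%:R * (~~ g B v)%:R.
rewrite (eq_avg (g := fun k => F (k %/ Q B) (k %% Q B))%N); last first.
  by move=> u _; rewrite /F /= -mulnb natrM.
rewrite avg_divmod// (eq_avg (g := fun u => (unhit g B u)%:R
    * avg (Q B) (fun v => (~~ g B v)%:R))); last by move=> u _; rewrite avgZ.
rewrite avgZr exprSr ler_pM ?avg_ge0 ?IHB ?H//.
by move=> b bB; apply: H; lia.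
Qed.

(** The hits that matter occur in blocks [b] and [b.+1]; every other block still
    contributes its factor [rho]. *)
Lemma avg_unhit_straddle_le (g gg : nat -> pred nat) (rho gam : R) B :
    0 <= rho -> 0 <= gam ->
    (forall b, (b < B.+1)%N -> avg (Q b) (fun v => (~~ g b v)%:R) <= rho) ->
    (forall b, (b < B)%N -> avg (Q b * Q b.+1) (fun v => (gg b v)%:R) <= gam) ->
  avg (P B.+1) (fun u => (unhit g B.+1 u && straddle gg B.+1 u)%:R)
    <= B%:R * gam * rho ^+ B.-1.
Proof.
move=> rho0 gam0; elim: B => [|B IHB] Hg Hgg.
  rewrite (eq_avg (g := fun=> 0)) ?avg_cst ?mul0r// => u _.
  by rewrite /= andbF.
pose F u v : R := (unhit g B.+1 u && straddle gg B.+1 u)%:R * (~~ g B.+1 v)%:R.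
pose QQ := (Q B * Q B.+1)%N.
pose G u v : R := (unhit g B u)%:R * (gg B v)%:R.
apply: (@le_trans _ _ (avg (P B.+2) (fun u =>
    F (u %/ Q B.+1)%N (u %% Q B.+1)%N + G (u %/ QQ)%N (u %% QQ)%N))).
  apply: le_avg => u _; rewrite /F /G /QQ [in (_ %/ (_ * _))%N]mulnC divnMA.
  rewrite mulnC -!natrM !mulnb -natrD ler_nat.
  have cases (h k k' s x : bool) : (((h && k) && k') && (s || x) <=
      ((h && k) && s) && k' + (h && x))%N.
    by case: h; case: k; case: k'; case: s; case: x.
  rewrite [(Q B.+1 * _)%N]mulnC.
  exact: (cases (unhit g B _) (~~ g B _) (~~ g B.+1 _) (straddle gg B.+1 _)).
rewrite avgD.
have -> : avg (P B.+2) (fun u => G (u %/ QQ)%N (u %% QQ)%N) =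
    avg (P B) (fun u => (unhit g B u)%:R) * avg QQ (fun v => (gg B v)%:R).
  rewrite !PS -mulnA avg_divmod ?muln_gt0 ?Q_gt0//.
  by rewrite -avgZr; apply: eq_avg => u _; rewrite avgZ.
have -> : avg (P B.+2) (fun u => F (u %/ Q B.+1)%N (u %% Q B.+1)%N) =
    avg (P B.+1) (fun u => (unhit g B.+1 u && straddle gg B.+1 u)%:R)
    * avg (Q B.+1) (fun v => (~~ g B.+1 v)%:R).
  rewrite [P B.+2]PS avg_divmod//.
  by rewrite -avgZr; apply: eq_avg => u _; rewrite avgZ.
apply: (@le_trans _ _ (B%:R * gam * rho ^+ B.-1 * rho + rho ^+ B * gam)).
  apply: lerD; apply: ler_pM; rewrite ?avg_ge0//.
  - by apply: IHB => b bB; [apply: Hg|apply: Hgg]; lia.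
  - by apply: Hg; lia.
  - by apply: avg_unhit_le => // b bB; apply: Hg; lia.
  - by apply: Hgg; lia.
rewrite /= -natr1 mulrDl mul1r mulrDl [gam * _]mulrC lerD2r.
by case: B {F QQ G IHB Hg Hgg} => [|B]/=; rewrite ?mul0r// exprSr mulrA.
Qed.

Lemma expR_le_quad (x th : R) : 0 <= x -> x <= th -> th <= 1 / 2 ->
  expR x <= 1 + (1 + 2 * th) * x.
Proof.
move=> x0 xth th2.
have x1 : 0 < 1 - x by lra.
apply: (@le_trans _ _ (1 - x)^-1).
  rewrite -[x in expR x]opprK expRN lef_pV2 ?posrE ?expR_gt0//.
  by have := expR_ge1Dx (- x).
rewrite -[leLHS]mul1r ler_pdivrMr//; nra.
Qed.

(** Each block kills at most [M] of the surviving indices, and each of them with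
    probability at most [p]. Exponential moments then survive one block at the
    cost of multiplying their parameter by [1 - p * (1 + 2 * th)]. *)
Lemma avg_exp_survivors_le (I : finType) (C : pred I)
    (g : I -> nat -> pred nat) (M p th lam : R) B :
    0 <= M -> 0 <= p -> 0 <= lam -> lam * M <= th -> th <= 1 / 2 ->
    p * (1 + 2 * th) <= 1 ->
    (forall b v, (b < B)%N -> (v < Q b)%N -> \sum_(i in C) (g i b v)%:R <= M) ->
    (forall b i, (b < B)%N -> i \in C ->
       avg (Q b) (fun v => (g i b v)%:R) <= p) ->
  avg (P B) (fun u => expR (- lam * \sum_(i in C) (unhit (g i) B u)%:R)) <=
  expR (- lam * ((1 - p * (1 + 2 * th)) ^+ B * #|C|%:R)).
Proof.
move=> M0 p0; elim: B lam => [|B IHB] lam lam0 lamM th2 pth HM Hp.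
  rewrite (eq_avg (g := fun=> expR (- lam * #|C|%:R))) ?avg_cst ?expr0 ?mul1r//.
  by move=> u _; rewrite /= sumr_const.
have th0 : 0 <= th by apply: le_trans lamM; exact: mulr_ge0.
pose w u : R := \sum_(i in C) (unhit (g i) B u)%:R.
pose D u v : R := \sum_(i in C) (unhit (g i) B u && g i B v)%:R.
pose r := 1 - p * (1 + 2 * th).
have r0 : 0 <= r by rewrite /r; lra.
have r1 : r <= 1 by rewrite /r; nra.
have w0 u : 0 <= w u by apply: sumr_ge0.
have D0 u v : 0 <= D u v by apply: sumr_ge0.
have DM u v : (v < Q B)%N -> D u v <= M.
  move=> vQ; apply: le_trans (HM B v _ vQ) => //.
  by apply: ler_sum => i _; rewrite ler_nat; case: (unhit _ _ _).
rewrite PS (eq_avg (g := fun k => expR (- lam *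
    (w (k %/ Q B)%N - D (k %/ Q B)%N (k %% Q B)%N)))); last first.
  move=> u _; congr expR; congr (_ * _); rewrite /w /D -sumrB.
  apply: eq_bigr => i _ /=.
  by case: (unhit _ _ _); case: (g _ _ _); rewrite /= ?subr0 ?subrr.
rewrite (avg_divmod _ (fun u v => expR (- lam * (w u - D u v))))//.
apply: (@le_trans _ _ (avg (P B) (fun u => expR (- (lam * r) * w u)))).
  apply: le_avg => u _.
  apply: (@le_trans _ _ (avg (Q B) (fun v =>
      expR (- lam * w u) * (1 + (1 + 2 * th) * (lam * D u v))))).
    apply: le_avg => v vQ; rewrite mulrBr mulNr mulNr opprK expRD.
    rewrite ler_wpM2l ?expR_ge0// expR_le_quad// ?mulr_ge0//.
    by apply: le_trans lamM; rewrite ler_wpM2l// DM.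
  rewrite avgZ avgD avg_cst// 2!avgZ.
  have Dp : avg (Q B) (D u) <= p * w u.
    rewrite /D avg_sum /w mulr_sumr; apply: ler_sum => i iC.
    case: (unhit _ _ _) => /=; first by rewrite mulr1 Hp.
    by rewrite avg_cst// mulr0.
  apply: (@le_trans _ _ (expR (- lam * w u) *
      expR ((1 + 2 * th) * (lam * (p * w u))))).
    rewrite ler_wpM2l ?expR_ge0//; apply: le_trans (expR_ge1Dx _).
    by rewrite lerD2l !ler_wpM2l//; lra.
  rewrite -expRD ler_expR le_eqVlt; apply/orP; left; apply/eqP.
  by rewrite /r; ring.
have lamr : lam * r <= lam by rewrite ler_piMr.
apply: le_trans (IHB (lam * r) _ _ th2 pth _ _) _.
- exact: mulr_ge0.
- by apply: le_trans lamM; rewrite ler_wpM2r.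
- by move=> b v bB; apply: HM; exact: leqW.
- by move=> b i bB; apply: Hp; exact: leqW.
rewrite -/r exprS le_eqVlt; apply/orP; left; apply/eqP; congr expR; ring.
Qed.

End Blocks.

(** * Arcs, cells and gaps on the circle *)

Section Circle.
Variable R : realType.
Implicit Types (x : circle R) (s t g m al be : R) (I : set R).

Definition crep x : R := repr x - (Num.floor (repr x))%:~R.

Lemma crep_ge0 x : 0 <= crep x.
Proof. by rewrite subr_ge0; case/andP: (floor_itv (repr x)). Qed.

Lemma crep_lt1 x : crep x < 1.
Proof.
by rewrite ltrBlDl; case/andP: (floor_itv (repr x)); rewrite intrD.
Qed.

Lemma circle_pi_addz s (z : int) : circle_pi (s + z%:~R) = circle_pi s.
Proof. by apply/circle_eqP; rewrite addrC addKr intr_int. Qed.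

Lemma crepK x : circle_pi (crep x) = x.
Proof. by rewrite /crep -intrN circle_pi_addz /circle_pi reprK. Qed.

Lemma circle_pi_eq s t :
  circle_pi s = circle_pi t -> exists z : int, s = t + z%:~R.
Proof.
by move=> /circle_eqP /intrP[z st]; exists z; rewrite -st addrC subrK.
Qed.

Lemma circle_pi_inj s t : 0 <= s -> s < 1 -> 0 <= t -> t < 1 ->
  circle_pi s = circle_pi t -> s = t.
Proof.
move=> s0 s1 t0 t1 /circle_pi_eq[z st].
have : (z%:~R : R) < 1 by lra.
have : -1 < (z%:~R : R) by lra.
rewrite -[-1]/(-1)%:~R -[1]/1%:~R !ltr_int => z1 z2.
by rewrite st (_ : z = 0) ?addr0//; lia.
Qed.

Lemma circle_piMn s n : circle_pi (s *+ n) = circle_pi s *+ n.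
Proof. exact: (raddfMn (\pi_(circle R))%qT). Qed.

Lemma crepMn x n :
  crep (x *+ n) = n%:R * crep x - (Num.floor (n%:R * crep x))%:~R.
Proof.
apply: circle_pi_inj; rewrite ?crep_ge0 ?crep_lt1//.
- by rewrite subr_ge0; case/andP: (floor_itv (n%:R * crep x)).
- by rewrite ltrBlDl; case/andP: (floor_itv (n%:R * crep x)); rewrite intrD.
by rewrite -intrN circle_pi_addz crepK mulr_natl circle_piMn crepK.
Qed.

(** For a divisibility chain [a 1 | ... | a n = T], this number encodes the
    mixed-radix digits of [x] in the first [n] places. *)
Definition digits T x : nat := Num.truncn (T%:R * crep x).

Lemma digits_lt T x : (0 < T)%N -> (digits T x < T)%N.
Proof.
move=> T0; rewrite /digits truncn_lt_nat ?mulr_ge0 ?crep_ge0//.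
by rewrite -[ltRHS]mulr1 ltr_pM2l ?ltr0n// crep_lt1.
Qed.

Lemma digits_itv T x :
  (digits T x)%:R <= T%:R * crep x < (digits T x).+1%:R.
Proof. by apply: truncn_itv; rewrite mulr_ge0 ?crep_ge0. Qed.

Lemma digits_div P Q x : (0 < Q)%N ->
  (digits (P * Q) x %/ Q)%N = digits P x.
Proof.
move=> Q0; apply/esym/truncn_def; have /andP[d1 d2] := digits_itv (P * Q) x.
have Q0' : 0 < Q%:R :> R by rewrite ltr0n.
rewrite -(ler_pM2r Q0') -[X in _ && X](ltr_pM2r Q0') -!natrM.
have -> : P%:R * crep x * Q%:R = (P * Q)%:R * crep x by rewrite natrM; ring.
apply/andP; split; first by apply: le_trans d1; rewrite ler_nat leq_trunc_div.
by apply: lt_le_trans d2 _; rewrite ler_nat -ltn_divLR.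
Qed.

(** Multiplication by [n] shifts the expansion: it drops the leading digits. *)
Lemma digits_mod n T x : (0 < n)%N -> (0 < T)%N ->
  (digits (n * T) x %% T)%N = digits T (x *+ n).
Proof.
move=> n0 T0; have dT := digits_lt (x *+ n) T0.
have nx0 : 0 <= n%:R * crep x by rewrite mulr_ge0 ?crep_ge0.
suff -> : digits (n * T) x
    = (Num.truncn (n%:R * crep x) * T + digits T (x *+ n))%N.
  by rewrite modnMDl modn_small.
apply: truncn_def; have /andP[] := digits_itv T (x *+ n).
rewrite crepMn.
have -> : (Num.floor (n%:R * crep x))%:~R = (Num.truncn (n%:R * crep x))%:R :> R.
  by rewrite truncn_floor nx0 natr_absz ger0_norm// floor_ge0.
rewrite -!natr1 natrD !natrM; set k := (digits _ _)%:R.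
set u := (Num.truncn _)%:R => h1 h2; apply/andP; split; nra.
Qed.

Lemma preimage_arc I : @circle_pi R @^-1` (@circle_pi R @` I) =
  \bigcup_(z : int) ((fun t : R => t + z%:~R) @^-1` I).
Proof.
apply/seteqP; split => [t /= [s Is /esym /circle_pi_eq[z tE]]|t [z _ /= It]].
  by exists (- z) => //=; rewrite tE intrN addrK.
by exists (t + z%:~R) => //; rewrite circle_pi_addz.
Qed.

Lemma measurable_arc I : is_interval I ->
  measurable (@circle_pi R @` I : set (circle R)).
Proof.
move=> itvI; rewrite /measurable /= /circle_measurable /image_set_system /=.
rewrite setTI preimage_arc; apply: countable_bigcupT_measurable => //.
move=> z; rewrite -[X in measurable X]setTI.
have mI := is_interval_measurable itvI.
have mf : measurable_fun [set: R] (fun t : R => t + z%:~R).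
  by apply: measurable_funD.
exact: mf.
Qed.

Lemma circle_measureE (J : set (circle R)) :
  circle_measure J = lebesgue_measure (@circle_pi R @^-1` J `&` `[0, 1[).
Proof. by []. Qed.

Lemma arc_measure_le I m g : is_interval I -> 0 <= g ->
  I `<=` `[m, m + g] -> (circle_measure (@circle_pi R @` I) <= g%:E)%E.
Proof.
move=> itvI g0 Img; have mJ := measurable_arc itvI.
have [g1|g1] := leP 1 g.
  by apply: le_trans (probability_le1 _ mJ) _; rewrite lee_fin.
(* Translate [m] into [0, 1[: then only two integer translates of
   [m', m' + g] meet the fundamental domain. *)
pose m' := m - (Num.floor m)%:~R.
have /andP[m'0 m'1] : 0 <= m' < 1.
  by rewrite /m'; case/andP: (floor_itv m); rewrite intrD => *; apply/andP; split; lra.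
have sub t : 0 <= t -> t < 1 -> (@circle_pi R @` I) (circle_pi t) ->
    m' <= t <= m' + g \/ t <= m' + g - 1.
  move=> t0 t1 /= [s Is /circle_pi_eq[z sE]].
  have /andP[ms sg] := Img s Is; rewrite !bnd_simp in ms sg.
  pose w := z - Num.floor m.
  have wE : w%:~R = z%:~R - (Num.floor m)%:~R :> R by rewrite intrD intrN.
  have : (-1)%:~R < w%:~R :> R by rewrite wE; rewrite /m' in m'0 m'1; lra.
  have : w%:~R < 2%:~R :> R by rewrite wE; rewrite /m' in m'0 m'1; lra.
  rewrite !ltr_int => w2 w1; have [w0|w0] := eqVneq w 0.
    by left; move: wE; rewrite w0 mulr0z /m' => wE; apply/andP; split; lra.
  have {}w0 : w = 1 by lia.
  by right; move: wE; rewrite w0 /m' => wE; lra.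
rewrite circle_measureE.
have mpre : measurable (@circle_pi R @^-1` (@circle_pi R @` I) `&` `[0, 1[).
  by apply: measurableI => //; rewrite -[X in measurable X]setTI.
have [mg|mg] := ltP (m' + g) 1.
  apply: (@le_trans _ _ (lebesgue_measure (`[m', m' + g]%classic : set R))).
    apply: le_measure; rewrite ?inE// => t /= [Jt]; rewrite in_itv/=.
    case/andP => t0 t1; rewrite in_itv/=.
    by case: (sub t t0 t1 Jt) => // ?; exfalso; lra.
  rewrite lebesgue_measure_itv/=; case: ifPn => // _.
  by rewrite -EFinD lee_fin; lra.
apply: (@le_trans _ _ (lebesgue_measure
    (`[m', 1]%classic `|` `[0, m' + g - 1]%classic : set R))).
  apply: le_measure; rewrite ?inE//; first exact: measurableU.
  move=> t /= [Jt]; rewrite in_itv/= => /andP[t0 t1].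
  case: (sub t t0 t1 Jt) => [/andP[? ?]|?]; rewrite !in_itv/=.
    by left; apply/andP; split; lra.
  by right; apply/andP; split; lra.
apply: (@le_trans _ _ (lebesgue_measure (`[m', 1%R]%classic : set R) +
    lebesgue_measure (`[0%R, (m' + g - 1)%R]%classic : set R))%E).
  exact: measureU2.
rewrite !lebesgue_measure_itv/= !lte_fin m'1.
case: ifPn => _; rewrite -?EFinD lee_fin; lra.
Qed.

Lemma arc_measure_ge al be : 0 <= al -> al <= be -> be <= 1 ->
  ((be - al)%:E <= circle_measure (@circle_pi R @` `[al, be[%classic))%E.
Proof.
move=> a0 ab b1; rewrite circle_measureE.
apply: (@le_trans _ _ (lebesgue_measure (`[al, be[%classic : set R))).
  rewrite lebesgue_measure_itv/= lte_fin; case: ifPn; first by rewrite EFinD.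
  by rewrite -leNgt lee_fin => ?; lra.
apply: le_measure; rewrite ?inE//.
  apply: measurableI => //; rewrite -[X in measurable X]setTI.
  by apply: measurable_circle_pi => //; apply: measurable_arc; exact: interval_is_interval.
move=> t /=; rewrite in_itv/= => /andP[at_ tb]; split.
  by exists t => //=; rewrite in_itv/= at_.
by rewrite in_itv/=; apply/andP; split; lra.
Qed.

(** Transfer from finite averages to the measure of the circle: the points with
    given digits form an arc of length [1 / T]. *)
Lemma digits_event T (E : pred nat) : (0 < T)%N ->
  measurable [set x | E (digits T x)] /\
  (circle_measure [set x | E (digits T x)] <= (avg T (fun u => (E u)%:R))%:E)%E.
Proof.
move=> T0; have T0' : 0 < T%:R :> R by rewrite ltr0n.
pose cell j : set (circle R) :=
  if E j then @circle_pi R @` `[j%:R / T%:R, j.+1%:R / T%:R[%classic else set0.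
have mcell j : measurable (cell j).
  rewrite /cell; case: ifP => // _; apply: measurable_arc.
  exact: interval_is_interval.
have cellE : [set x | E (digits T x)] = \big[setU/set0]_(j < T) cell j.
  rewrite -bigcup_mkord; apply/seteqP; split => x /=.
    move=> Ex; exists (digits T x); first exact: digits_lt.
    rewrite /cell Ex; exists (crep x); last exact: crepK.
    rewrite /= in_itv/= ler_pdivrMr// ltr_pdivlMr// [crep x * _]mulrC.
    exact: digits_itv.
  move=> [j /= jT]; rewrite /cell; case: ifP => // Ej [t /=].
  rewrite in_itv/= ler_pdivrMr// ltr_pdivlMr// => /andP[jt tj] xt.
  have t0 : 0 <= t by rewrite -(pmulr_lge0 _ T0'); exact: le_trans jt.
  have t1 : t < 1.
    by rewrite -(ltr_pM2r T0') mul1r; apply: lt_le_trans tj _; rewrite ler_nat.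
  have tE : crep x = t.
    by apply: circle_pi_inj; rewrite ?crep_ge0 ?crep_lt1// xt crepK.
  rewrite /digits tE (_ : Num.truncn _ = j)//.
  by apply: truncn_def; rewrite mulrC jt tj.
split; first by rewrite cellE; exact: bigsetU_measurable.
apply: (@le_trans _ _ (\sum_(j < T) circle_measure (cell j))%E).
  apply: content_subadditive => //.
  - by rewrite cellE; exact: bigsetU_measurable.
  - by rewrite cellE.
rewrite /avg mulr_suml big_mkord -sumEFin; apply: lee_sum => j _.
rewrite /cell; case: ifP => _; last by rewrite measure0 mul0r.
apply: (@arc_measure_le _ (j%:R / T%:R)).
- exact: interval_is_interval.
- by rewrite mul1r invr_ge0 ltW.
by move=> t /=; rewrite !in_itv/= mul1r -natr1 mulrDl mul1r => /andP[-> /ltW].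
Qed.

Variable a : nat -> nat.

Lemma max_gap_ge N x al be : 0 <= al -> al <= be -> be <= 1 ->
    (forall n, (1 <= n <= N)%N -> ~ (al <= crep (x *+ a n) < be)) ->
  be - al <= max_gap a N x.
Proof.
move=> a0 ab b1 H; set J := @circle_pi R @` `[al, be[%classic.
have arcJ : is_arc J by exists `[al, be[%classic => //; exact: interval_is_interval.
have mJ : measurable J by apply: measurable_arc; exact: interval_is_interval.
have finJ (K : set (circle R)) : measurable K -> circle_measure K \is a fin_num.
  exact: fin_num_measure.
apply: (@le_trans _ _ (arc_length J)).
  rewrite -lee_fin /arc_length fineK ?finJ//; exact: arc_measure_ge.
apply: ub_le_sup.
  exists 1 => _ [K [[I itvI KE] _] <-].
  have mK : measurable K by rewrite KE; exact: measurable_arc.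
  by rewrite -lee_fin /arc_length fineK ?finJ//; exact: probability_le1.
exists J => //; split=> //; apply/seteqP; split => // y [[t /= + ty] [n /= n1N ny]].
rewrite in_itv/= => tab; apply: (H n n1N).
suff -> : crep (x *+ a n) = t by [].
case/andP: tab => ? ?; apply: circle_pi_inj; rewrite ?crep_ge0 ?crep_lt1//.
- lra.
- lra.
by rewrite crepK ny.
Qed.

(** An arc is the image of an interval of diameter at most [g], unless it
    contains the image of a segment longer than [g]; translating by an integer,
    one may assume that the segment starts in [0, 1[. *)
Lemma max_gap_le N x g : 0 <= g ->
    (forall p q, 0 <= p -> p < 1 -> g < q - p ->
       exists n t, [/\ (1 <= n <= N)%N, p <= t <= q & circle_pi t = x *+ a n]) ->
  max_gap a N x <= g.
Proof.
move=> g0 H; apply: ge_sup.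
  exists (arc_length (set0 : set (circle R))); exists set0 => //; split.
    by exists set0; [move=> ? ? []|rewrite image_set0].
  by rewrite set0I.
move=> _ [J [[I itvI JE] Jx] <-].
have mJ : measurable J by rewrite JE; exact: measurable_arc.
rewrite -lee_fin /arc_length fineK ?fin_num_measure//.
have diam p q : I p -> I q -> q - p <= g.
  move=> Ip Iq; rewrite leNgt; apply/negP => gpq.
  pose z := Num.floor p; have /andP[zp pz] := floor_itv p.
  rewrite intrD in pz.
  have [||| n [t [nN /andP[pt tq] tx]]] := H (p - z%:~R) (q - z%:~R).
  - by rewrite subr_ge0.
  - by rewrite ltrBlDl.
  - lra.
  have : (J `&` orbit_set a N x) (x *+ a n).
    split; last by exists n.
    rewrite JE; exists (t + z%:~R); last by rewrite circle_pi_addz.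
    by apply: (itvI p q) => //; apply/andP; split; lra.
  by rewrite Jx.
have [I0|/set0P[p0 Ip0]] := eqVneq I set0; first by rewrite JE I0 image_set0 measure0 lee_fin.
rewrite JE; apply: (@arc_measure_le _ (inf I)) => // t It /=.
have hinf : has_inf I.
  split; first by exists p0.
  by exists (p0 - g) => s Is; have := diam _ _ Is Ip0; lra.
rewrite in_itv/= (ge_inf hinf.2 It)/= -lerBlDr.
apply: lb_le_inf; first by exists p0.
by move=> s Is; have := diam _ _ Is It; lra.
Qed.

Lemma max_gap_nonincr N N' x : (N <= N')%N -> max_gap a N' x <= max_gap a N x.
Proof.
move=> NN'; apply: ge_sup.
  exists (arc_length (set0 : set (circle R))); exists set0 => //; split.
    by exists set0; [move=> ? ? []|rewrite image_set0].
  by rewrite set0I.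
move=> _ [J [arcJ Jx] <-]; apply: ub_le_sup.
  exists 1 => _ [K [[I itvI KE] _] <-].
  have mK : measurable K by rewrite KE; exact: measurable_arc.
  rewrite -lee_fin /arc_length fineK ?fin_num_measure//.
  exact: probability_le1.
exists J => //; split=> //; apply/seteqP; split => // y [Jy [n /= nN ny]].
have : (J `&` orbit_set a N' x) y by split=> //; exists n => //=; lia.
by rewrite Jx.
Qed.

End Circle.

(** * Blocks of a lacunary divisibility chain *)

Section Chain.
Variables (R : realType) (A : nat -> nat).
Hypothesis A_gt0 : forall n, (0 < A n)%N.
Hypothesis A_dvd : forall n, (A n %| A n.+1)%N.
Hypothesis A_double : forall n, (2 * A n <= A n.+1)%N.
Implicit Types (x : circle R) (al be S : R).

Lemma chain_dvd m n : (m <= n)%N -> (A m %| A n)%N.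
Proof.
elim: n => [|n IH]; first by rewrite leqn0 => /eqP ->.
rewrite leq_eqVlt => /predU1P[-> //|mn]; exact: dvdn_trans (IH mn) (A_dvd n).
Qed.

Lemma chain_divK m n : (m <= n)%N -> (A m * (A n %/ A m))%N = A n.
Proof. by move=> mn; rewrite mulnC divnK// chain_dvd. Qed.

Lemma chain_ratio_gt0 m n : (m <= n)%N -> (0 < A n %/ A m)%N.
Proof. by move=> mn; rewrite divn_gt0// dvdn_leq// chain_dvd. Qed.

Lemma chain_ratioM m p n : (m <= p)%N -> (p <= n)%N ->
  (A n %/ A m = (A p %/ A m) * (A n %/ A p))%N.
Proof.
move=> mp pn; rewrite -[in LHS](chain_divK pn) -{1}(chain_divK mp).
by rewrite -mulnA mulKn.
Qed.

Lemma chain_ratio_dvd m p n : (m <= p)%N -> (p <= n)%N ->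
  (A n %/ A p %| A n %/ A m)%N.
Proof. by move=> mp pn; rewrite (chain_ratioM mp pn) dvdn_mull. Qed.

Lemma chain_ratio_ge m n : (m <= n)%N -> (2 ^ (n - m) <= A n %/ A m)%N.
Proof.
move=> mn; rewrite leq_divRL//; rewrite -{2}(subnK mn).
elim: (n - m)%N => [|j IH]; first by rewrite mul1n.
by apply: leq_trans (A_double _); rewrite expnS -mulnA leq_mul2l IH.
Qed.

(** Length of the blocks, and number of their points that are decided by the
    digits of their own block. *)
Variables W M0 : nat.
Hypothesis M0W : (M0 <= W)%N.

Definition bP b := A (b * W).
Definition bQ b := (A (b.+1 * W) %/ A (b * W))%N.

Lemma bP_gt0 b : (0 < bP b)%N. Proof. exact: A_gt0. Qed.

Lemma bQ_gt0 b : (0 < bQ b)%N.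
Proof. by rewrite chain_ratio_gt0// leq_mul2r leqnSn orbT. Qed.

Lemma bPS b : bP b.+1 = (bP b * bQ b)%N.
Proof. by rewrite /bP /bQ chain_divK// leq_mul2r leqnSn orbT. Qed.

(** The points [b * W + kap * j] are truncated at the end of block [b]: this makes
    the event a function of the digits [v] of the block. *)
Definition block_hit al be (kap M b v : nat) : bool :=
  has (fun j => hit al be (A (b.+1 * W) %/ A (b * W + kap * j)) v) (iota 0 M).

(** The last points of block [b] have too few digits left in it for a precise
    truncation, and are truncated at the end of the next block. *)
Definition gap_hit al be (b v : nat) : bool :=
  has (fun n => hit al be (A (b.+2 * W) %/ A n) v)
    (iota (b * W + M0) (W - M0)).

Notation unhit := (unhit bQ).
Notation straddle := (straddle bQ).

Lemma unhitP (g : nat -> pred nat) x B :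
  unhit g B (digits (bP B) x) <->
  forall b, (b < B)%N -> ~~ g b (digits (bP b.+1) x %% bQ b)%N.
Proof.
elim: B => [|B IHB]; first by split.
rewrite /= {1}bPS digits_div ?bQ_gt0//; split.
  by move=> /andP[/IHB uB gB] b; rewrite ltnS leq_eqVlt => /predU1P[->|/uB].
by move=> H; rewrite H// andbT; apply/IHB => b bB; apply: H; lia.
Qed.

Lemma straddlePn (gg : nat -> pred nat) x B :
  ~~ straddle gg B.+1 (digits (bP B.+1) x) <->
  forall b, (b < B)%N -> ~~ gg b (digits (bP b.+2) x %% (bQ b * bQ b.+1))%N.
Proof.
elim: B => [|B IHB]; first by split.
rewrite [straddle _ _ _]/= -/(straddle gg B.+1 _) negb_or.
rewrite {1}[bP B.+2]bPS digits_div ?bQ_gt0//; split.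
  by move=> /andP[/IHB uB gB] b; rewrite ltnS leq_eqVlt => /predU1P[->|/uB].
by move=> H; rewrite H// andbT; apply/IHB => b bB; apply: H; lia.
Qed.

Lemma hit_digits al be t x : (0 < t)%N ->
  hit al be t (digits t x) -> al <= crep x < be + t%:R^-1.
Proof.
move=> t0; rewrite /hit modn_small ?digits_lt//.
have t0' : 0 < t%:R :> R by rewrite ltr0n.
have /andP[d1 d2] := digits_itv t x; rewrite -natr1 in d2 => /andP[h1 h2].
apply/andP; split; first by rewrite -(ler_pM2r t0'); lra.
by rewrite -(ltr_pM2r t0') [ltRHS]mulrDl mulVf ?gt_eqF//; lra.
Qed.

Lemma hit_digitsN al be t x : (0 < t)%N ->
  ~~ hit al be t (digits t x) -> ~ (al + t%:R^-1 <= crep x < be).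
Proof.
move=> t0; rewrite /hit modn_small ?digits_lt//.
have t0' : 0 < t%:R :> R by rewrite ltr0n.
have /andP[d1 d2] := digits_itv t x; rewrite -natr1 in d2 => /negP h /andP[h1 h2].
apply: h; apply/andP; split.
  by move: h1; rewrite -(ler_pM2r t0') [leLHS]mulrDl mulVf ?gt_eqF//; lra.
by move: h2; rewrite -(ltr_pM2r t0'); lra.
Qed.

Lemma digits_orbit al be n m Q x : (n <= m)%N -> (A m %/ A n %| Q)%N ->
  hit al be (A m %/ A n) (digits (A m) x %% Q) =
  hit al be (A m %/ A n) (digits (A m %/ A n) (x *+ A n)).
Proof.
move=> nm tQ; have t0 := chain_ratio_gt0 nm.
have := digits_mod x (A_gt0 n) t0; rewrite chain_divK// => <-.
by rewrite hit_mod// /hit modn_mod.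
Qed.

Lemma chain_resolution n m : (n + (W - M0) <= m)%N ->
  (A m %/ A n)%:R^-1 <= (2 ^ (W - M0))%:R^-1 :> R.
Proof.
move=> nm; rewrite lef_pV2 ?posrE ?ltr0n ?expn_gt0// ?chain_ratio_gt0//; last lia.
rewrite ler_nat; apply: leq_trans (chain_ratio_ge _); last lia.
by rewrite leq_exp2l//; lia.
Qed.

Let tau : R := (2 ^ (W - M0))%:R^-1.

(** Truncation moves the points of the orbit to the left by at most [tau], so a
    hit by a truncated point costs an enlargement of the interval. *)
Lemma orbit_hit al be kap M x B : (kap * M <= M0)%N -> (0 < kap)%N ->
  ~~ unhit (block_hit al be kap M) B (digits (bP B) x) ->
  exists2 n, (n < B * W)%N & al <= crep (x *+ A n) < be + tau.
Proof.
move=> kM kap0 /negP; rewrite unhitP => /existsNP[b /not_implyP[bB /negP]].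
rewrite negbK => /hasP[j]; rewrite mem_iota add0n => /andP[_ jM].
have jM0 : (kap * j < M0)%N by nia.
have bBW : (b.+1 * W <= B * W)%N by rewrite leq_mul2r bB orbT.
rewrite digits_orbit; first last.
- by apply: chain_ratio_dvd; lia.
- by lia.
have t0 := @chain_ratio_gt0 (b * W + kap * j) (b.+1 * W) ltac:(lia).
move=> /(hit_digits t0)/andP[h1 h2]; exists (b * W + kap * j)%N; first lia.
rewrite h1/=; apply: lt_le_trans h2 _; rewrite lerD2l.
by apply: chain_resolution; lia.
Qed.

(** For the same reason, avoidance by all truncated points only survives on a
    slightly shortened interval. *)
Lemma orbit_avoid al be x B : (0 < W)%N ->
  unhit (block_hit al be 1 M0) B.+1 (digits (bP B.+1) x) ->
  ~~ straddle (gap_hit al be) B.+1 (digits (bP B.+1) x) ->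
  forall n, (n < B * W)%N -> ~ (al + tau <= crep (x *+ A n) < be).
Proof.
move=> W0 /unhitP uB /straddlePn sB n nBW /andP[h1 h2].
pose b := (n %/ W)%N; have nE := divn_eq n W; rewrite -/b in nE.
have nW := ltn_pmod n W0; set j := (n %% W)%N in nE nW.
have bB : (b < B)%N by rewrite /b ltn_divLR.
case: (ltnP j M0) => jM.
  have /negP := uB b ltac:(lia); apply; apply/hasP; exists j.
    by rewrite mem_iota.
  rewrite mul1n -nE digits_orbit; first last.
  - by apply: chain_ratio_dvd; lia.
  - by lia.
  have t0 := @chain_ratio_gt0 n (b.+1 * W) ltac:(lia).
  apply/negPn/negP => /(hit_digitsN t0); apply; rewrite h2 andbT.
  by apply: le_trans h1; rewrite lerD2l; apply: chain_resolution; lia.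
have /negP := sB b bB; apply; apply/hasP; exists n.
  by rewrite mem_iota; lia.
rewrite digits_orbit; first last.
- rewrite /bQ -(@chain_ratioM _ (b.+1 * W)); [|lia|lia].
  by apply: chain_ratio_dvd; lia.
- by lia.
have t0 := @chain_ratio_gt0 n (b.+2 * W) ltac:(lia).
apply/negPn/negP => /(hit_digitsN t0); apply; rewrite h2 andbT.
by apply: le_trans h1; rewrite lerD2l; apply: chain_resolution; lia.
Qed.

(** Short intervals only fail this near a fixed point of [y |-> s * y] with
    [s <= S]. There the orbit comes back soon after each visit: hits come in
    clusters, and the interval is missed more often than by independent points. *)
Definition good S al be : Prop := forall (s c : nat) (y : R),
  (1 < s)%N -> s%:R <= S -> al <= y < be -> al <= s%:R * y - c%:R < be -> False.

(** On a bad interval, clusters are removed by keeping one point out of [kap], so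
    that all frequency ratios exceed [S]. *)
Lemma block_hit_ge_chain S al be kap M b :
    0 < S -> 0 <= al -> al <= be -> be <= 1 -> (0 < kap)%N -> (kap * M <= M0)%N ->
    good S al be \/ S < (2 ^ kap)%:R ->
  M%:R * (be - al - tau)
    - M%:R * (be - al + tau) * (M%:R * (be - al) + 2 / S)
  <= avg (bQ b) (fun v => (block_hit al be kap M b v)%:R).
Proof.
move=> S0 a0 ab b1 kap0 kM gd.
pose t j := (A (b.+1 * W) %/ A (b * W + kap * j))%N.
have jW j : (j < M)%N -> (b * W + kap * j + (W - M0) <= b.+1 * W)%N by nia.
apply: (block_hit_ge (t := t)) => //; first exact: bQ_gt0.
- by move=> m mM; have := jW m mM; move=> ?; apply: chain_ratio_dvd; lia.
- by move=> m mM; have := jW m.+1 mM; move=> ?; apply: chain_ratio_dvd; nia.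
- move=> m mM; have := jW m.+1 mM; move=> jWm; rewrite /t.
  rewrite (@chain_ratioM (b * W + kap * m) (b * W + kap * m.+1)); [|nia|lia].
  rewrite leq_mul2r; apply/orP; right.
  apply: leq_trans (chain_ratio_ge _); last nia.
  by rewrite -{1}[2%N]expn1 leq_exp2l//; nia.
- by move=> m mM; apply: chain_resolution; exact: jW.
move=> m m' v mm' m'M; have m'W := jW m' m'M.
set t' := t m'; pose s := (A (b * W + kap * m') %/ A (b * W + kap * m))%N.
have tE : t m = (s * t')%N by rewrite /t /s /t' -chain_ratioM//; nia.
have t0' : 0 < t'%:R :> R by rewrite ltr0n chain_ratio_gt0//; lia.
have sge : (2 ^ kap <= s)%N.
  apply: leq_trans (chain_ratio_ge _); last nia.
  by rewrite leq_exp2l//; nia.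
have s1 : (1 < s)%N.
  by apply: leq_trans sge; rewrite -{1}[2%N]expn1 leq_exp2l.
rewrite tE natrM ler_pM2r// => sS.
case: gd => [gd|Sk]; last first.
  have : (2 ^ kap)%:R <= s%:R :> R by rewrite ler_nat.
  lra.
rewrite /hit => /andP[h1 h2] /andP[h3 h4].
have s0' : 0 < s%:R :> R by rewrite ltr0n ltnW.
pose w := (v %% (s * t'))%N; pose c := (w %/ t')%N.
have wE : w%:R = c%:R * t'%:R + (v %% t')%:R :> R.
  rewrite -natrM -natrD {1}(divn_eq w t'); congr (_ + _)%:R.
  by rewrite /w modn_dvdm// dvdn_mull.
rewrite -/w wE natrM in h1 h2.
apply: (gd s c (w%:R / (s%:R * t'%:R))) => //.
  by rewrite ler_pdivlMr ?mulr_gt0// ltr_pdivrMr ?mulr_gt0// wE h1.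
have -> : s%:R * (w%:R / (s%:R * t'%:R)) - c%:R = (v %% t')%:R / t'%:R :> R.
  by rewrite wE; field; rewrite ?gt_eqF.
by rewrite ler_pdivlMr// ltr_pdivrMr// h3.
Qed.

Lemma has_le_sum (T : Type) (p : pred T) (r : seq T) :
  (has p r)%:R <= \sum_(i <- r) (p i)%:R :> R.
Proof.
elim: r => [|i r IH]; first by rewrite big_nil.
rewrite big_cons /=; case: (p i) => /=; last by rewrite add0r.
by rewrite lerDl; apply: sumr_ge0.
Qed.

Lemma le_sum_iota (F : nat -> R) c m n :
  (forall i, (m <= i < m + n)%N -> F i <= c) ->
  \sum_(i <- iota m n) F i <= n%:R * c.
Proof.
elim: n m => [|n IH] m H; first by rewrite big_nil mul0r.
rewrite /= big_cons -natr1 mulrDl mul1r addrC lerD//; last by apply: H; lia.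
by apply: IH => i ?; apply: H; lia.
Qed.

Lemma block_hit_le al be M b : al <= be -> (M <= M0)%N ->
  avg (bQ b) (fun v => (block_hit al be 1 M b v)%:R) <= M%:R * (be - al + tau).
Proof.
move=> ab MM0; apply: (@le_trans _ _ (avg (bQ b) (fun v =>
    \sum_(j <- iota 0 M)
      (hit al be (A (b.+1 * W) %/ A (b * W + 1 * j)) v)%:R))).
  by apply: le_avg => v _; exact: has_le_sum.
rewrite avg_sum; apply: le_sum_iota => j jM.
apply: le_trans (avg_hit_le (bQ_gt0 b) _ ab) _.
  by apply: chain_ratio_dvd; lia.
by rewrite lerD2l; apply: chain_resolution; lia.
Qed.

Lemma gap_hit_le al be b : al <= be ->
  avg (bQ b * bQ b.+1) (fun v => (gap_hit al be b v)%:R)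
    <= (W - M0)%:R * (be - al + tau).
Proof.
move=> ab; pose F n v : R := (hit al be (A (b.+2 * W) %/ A n) v)%:R.
apply: (@le_trans _ _ (avg (bQ b * bQ b.+1) (fun v =>
    \sum_(n <- iota (b * W + M0) (W - M0)) F n v))).
  by apply: le_avg => v _; exact: has_le_sum.
rewrite avg_sum; apply: le_sum_iota => n nW.
have Q0 : (0 < bQ b * bQ b.+1)%N by rewrite muln_gt0 !bQ_gt0.
apply: le_trans (avg_hit_le Q0 _ ab) _.
  rewrite /bQ -(@chain_ratioM _ (b.+1 * W)); [|lia|lia].
  by apply: chain_ratio_dvd; lia.
by rewrite lerD2l; apply: chain_resolution; lia.
Qed.

(** Each of the [M] points hits at most one of the disjoint intervals. *)
Lemma sum_block_hit_le (I : finType) (C : pred I) (al be : I -> R) M b v :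
    (forall i j y, i \in C -> j \in C ->
       al i <= y < be i -> al j <= y < be j -> i = j) ->
  (M <= M0)%N ->
  \sum_(i in C) (block_hit (al i) (be i) 1 M b v)%:R <= M%:R :> R.
Proof.
move=> disj MM0.
pose F j i : R :=
  (hit (al i) (be i) (A (b.+1 * W) %/ A (b * W + 1 * j)) v)%:R.
apply: (@le_trans _ _ (\sum_(i in C) \sum_(0 <= j < M) F j i)).
  by apply: ler_sum => i _; rewrite /index_iota subn0; exact: has_le_sum.
rewrite exchange_big/= -[M in leRHS]subn0 -[leRHS]mulr1 mulr_natl.
rewrite -sumr_const_nat !big_mkord; apply: ler_sum => j _; rewrite /F.
have jM := ltn_ord j; set t := (_ %/ _)%N.
have t0 : 0 < t%:R :> R by rewrite ltr0n chain_ratio_gt0//; lia.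
have hitE i : hit (al i) (be i) t v -> al i <= (v %% t)%:R / t%:R < be i.
  by rewrite /hit ler_pdivlMr// ltr_pdivrMr.
have [i0 /andP[i0C hi0]|no] := pickP (fun i => (i \in C) && hit (al i) (be i) t v).
  rewrite (bigD1 i0)//= hi0 big1 ?addr0// => i /andP[iC ii0].
  case: (boolP (hit _ _ _ _)) => // hi; case/eqP: ii0.
  exact: disj iC i0C (hitE _ hi) (hitE _ hi0).
by rewrite big1// => i iC; have := no i; rewrite /= iC /= => ->.
Qed.

End Chain.

(** * Probability of avoiding the intervals of a grid *)

Section Avoid.
Variables (R : realType) (A : nat -> nat).
Hypothesis A_gt0 : forall n, (0 < A n)%N.
Hypothesis A_dvd : forall n, (A n %| A n.+1)%N.
Hypothesis A_double : forall n, (2 * A n <= A n.+1)%N.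
Variables W M0 S : nat.
Hypothesis M0W : (M0 <= W)%N.
Implicit Types (al L eta : R).

Let tau : R := (2 ^ (W - M0))%:R^-1.

Let tau_gt0 : 0 < tau.
Proof. by rewrite invr_gt0 ltr0n expn_gt0. Qed.

(** In this regime the second order terms of [block_hit_ge_chain] are
    negligible. *)
Variables (L eta : R).
Hypothesis L_gt0 : 0 < L.
Hypothesis eta_le : eta <= 1 / 16.
Hypothesis tauL : tau <= eta * L.
Hypothesis WL : W%:R * L <= eta.
Hypothesis S_gt0 : (0 < S)%N.
Hypothesis Seta : 2 / S%:R <= eta.

Let eta_ge0 : 0 <= eta.
Proof. by apply: le_trans WL; rewrite mulr_ge0// ltW. Qed.

Lemma block_miss_le al kap M b : 0 <= al -> al + L <= 1 -> (0 < kap)%N ->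
    (kap * M <= M0)%N -> (1 - eta) * (W%:R / kap%:R) <= M%:R ->
    good S%:R al (al + L) \/ (S < 2 ^ kap)%N ->
  avg (bQ A W b) (fun v => (~~ block_hit A W al (al + L) kap M b v)%:R) <=
  1 - (1 - 8 * eta) * (W%:R * L / kap%:R).
Proof.
move=> a0 aL kap0 kM Mge gd.
rewrite (eq_avg (g := fun v => 1 - (block_hit A W al (al + L) kap M b v)%:R));
  last by move=> v _; case: (block_hit _ _ _ _ _ _ _ _); rewrite /= ?subrr ?subr0.
rewrite avgD avgN avg_cst ?bQ_gt0// lerD2l lerN2.
have S0 : 0 < S%:R :> R by rewrite ltr0n.
have aL' : al <= al + L by rewrite lerDl ltW.
have gd' : good S%:R al (al + L) \/ S%:R < (2 ^ kap)%:R :> R.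
  by case: gd => [?|?]; [left|right; rewrite ltr_nat].
have := block_hit_ge_chain A_gt0 A_dvd A_double M0W b S0 a0 aL' aL kap0 kM gd'.
rewrite -/tau; apply: le_trans.
have -> : al + L - al = L by ring.
have MW : M%:R <= W%:R :> R 
  by rewrite ler_nat (leq_trans _ M0W)// (leq_trans _ kM)// leq_pmull.
have ML : M%:R * L <= eta by apply: le_trans WL; rewrite ler_wpM2r// ltW.
have M_ge0 : 0 <= M%:R :> R by [].
have L_ge0 := ltW L_gt0; have e0 := eta_ge0; have e1 := eta_le.
have kap0' : 0 < kap%:R :> R by rewrite ltr0n.
have x0 : 0 <= W%:R / kap%:R :> R by rewrite divr_ge0.
set x := W%:R / kap%:R in Mge x0 *.
have -> : W%:R * L / kap%:R = x * L by rewrite /x mulrAC.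
apply: (@le_trans _ _ (M%:R * L * (1 - 4 * eta))).
  apply: (@le_trans _ _ ((1 - eta) * x * L * (1 - 4 * eta))).
    have xL0 : 0 <= x * L by rewrite mulr_ge0// ltW.
    rewrite -subr_ge0; have -> : (1 - eta) * x * L * (1 - 4 * eta)
      - (1 - 8 * eta) * (x * L) = x * L * (eta * (3 + 4 * eta)) by ring.
    by rewrite !mulr_ge0//; lra.
  by apply: ler_wpM2r; [lra|apply: ler_wpM2r].
have h1 : M%:R * tau <= M%:R * (eta * L) by rewrite ler_wpM2l.
have h2 : M%:R * (L + tau) * (M%:R * L + 2 / S%:R) <=
    M%:R * (L + eta * L) * (eta + eta).
  apply: ler_pM.
  - by rewrite mulr_ge0// addr_ge0// ltW.
  - by rewrite addr_ge0 ?mulr_ge0// divr_ge0.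
  - by apply: ler_wpM2l => //; rewrite lerD2l.
  - exact: lerD.
have ML0 : 0 <= M%:R * L * (eta * (1 - 2 * eta)).
  by rewrite !mulr_ge0//; lra.
rewrite -subr_ge0; lra.
Qed.

Lemma unhit_avg_le al kap M B : 0 <= al -> al + L <= 1 -> (0 < kap)%N ->
    (kap * M <= M0)%N -> (1 - eta) * (W%:R / kap%:R) <= M%:R ->
    good S%:R al (al + L) \/ (S < 2 ^ kap)%N ->
  avg (bP A W B)
    (fun u => (unhit (bQ A W) (block_hit A W al (al + L) kap M) B u)%:R) <=
  expR (- ((1 - 8 * eta) * ((B * W)%:R * L / kap%:R))).
Proof.
move=> a0 aL kap0 kM Mge gd.
pose h := (1 - 8 * eta) * (W%:R * L / kap%:R).
have hB b : avg (bQ A W b) (fun v =>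
    (~~ block_hit A W al (al + L) kap M b v)%:R) <= 1 - h.
  exact: block_miss_le.
have h1 : 0 <= 1 - h by apply: le_trans (hB 0%N); exact: avg_ge0.
apply: le_trans (avg_unhit_le (P := bP A W) _ _ _ h1 _) _ => //.
- exact: bQ_gt0.
- exact: bP_gt0.
- exact: bPS.
apply: (@le_trans _ _ (expR (- h) ^+ B)).
  apply: lerXn2r; rewrite ?nnegrE ?expR_ge0//; exact: expR_ge1Dx.
rewrite -expRM_natr le_eqVlt; apply/orP; left; apply/eqP; congr expR.
by rewrite /h natrM; ring.
Qed.

(** A grid interval which is not good lies close to one of the boundedly many
    fixed points [c / (s - 1)]. *)
Lemma sum_not_good_le (h : R) n : 0 < h ->
  \sum_(0 <= i < n) (~~ `[< good S%:R (i%:R * h) (i%:R * h + L) >]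
      && (i%:R * h + L <= 1))%R%:R
    <= S.+1%:R * (S%:R * (3 * (L / h) + 1)) :> R.
Proof.
move=> h0; have L0 := L_gt0.
pose z s c : R := c%:R / (s%:R - 1).
pose G s c i : R :=
  ((z s c - 2 * L) / h <= i%:R < (z s c + L) / h)%R%:R.
apply: (@le_trans _ _ (\sum_(0 <= i < n)
    \sum_(0 <= s < S.+1) \sum_(0 <= c < S) G s c i)); last first.
  rewrite exchange_big/= -[S.+1 in leRHS]subn0 mulr_natl -sumr_const_nat.
  apply: ler_sum => s _; rewrite exchange_big/= -[S in leRHS]subn0 mulr_natl.
  rewrite -sumr_const_nat; apply: ler_sum => c _.
  apply: le_trans (sum_itv_le _ _) _.
    by rewrite ler_pM2r ?invr_gt0//; lra.
  by rewrite le_eqVlt; apply/orP; left; apply/eqP; field; rewrite gt_eqF.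
apply: ler_sum => i _; case: andP => [[/negP ng iL]|_]; last first.
  by do 2 (apply: sumr_ge0 => ? _); exact: ler0n.
suff [s [c [sS cS G1]]] : exists s c, [/\ (s < S.+1)%N, (c < S)%N & G s c i = 1].
  rewrite big_mkord (bigD1 (Ordinal sS))//= big_mkord (bigD1 (Ordinal cS))//= G1.
  rewrite -addrA lerDl addr_ge0//; apply: sumr_ge0 => *; first exact: ler0n.
  by apply: sumr_ge0 => *; exact: ler0n.
apply: contrapT => nsc; apply: ng; apply/asboolP => s c y s1 sS /andP[y1 y2].
move=> /andP[w1 w2]; apply: nsc; exists s, c.
have s1' : 1 < s%:R :> R by rewrite ltr1n.
have s2' : 2 <= s%:R :> R by rewrite ler_nat.
have ih0 : 0 <= i%:R * h by rewrite mulr_ge0// ltW.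
split; first by rewrite ltnS -(ler_nat R).
  by rewrite -(ltr_nat R); nra.
rewrite /G; have s10 : 0 < s%:R - 1 :> R by lra.
have zE : z s c * (s%:R - 1) = c%:R by rewrite /z mulfVK// gt_eqF.
have zy1 : z s c - L < y by nra.
have zy2 : y < z s c + L by nra.
rewrite ler_pdivrMr// ltr_pdivlMr//.
by rewrite (_ : _ && _)//; apply/andP; split; lra.
Qed.

End Avoid.

(** * The exceptional events at a fixed scale *)

Section Events.
Variables (R : realType) (A : nat -> nat).
Hypothesis A_gt0 : forall n, (0 < A n)%N.
Hypothesis A_dvd : forall n, (A n %| A n.+1)%N.
Hypothesis A_double : forall n, (2 * A n <= A n.+1)%N.
Variables W M0 S B : nat.
Hypothesis M0W : (M0 <= W)%N.

Let tau : R := (2 ^ (W - M0))%:R^-1.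
Let N := (B * W)%N.

Variables (L eta : R).
Hypothesis L_gt0 : 0 < L.
Hypothesis eta_le : eta <= 1 / 16.
Hypothesis tauL : tau <= eta * L.
Hypothesis WL : W%:R * L <= eta.
Hypothesis S_gt0 : (0 < S)%N.
Hypothesis Seta : 2 / S%:R <= eta.

Let tau_ge0 : 0 <= tau.
Proof. by rewrite invr_ge0 ler0n. Qed.

Let eta_ge0 : 0 <= eta.
Proof. by apply: le_trans WL; rewrite mulr_ge0// ltW. Qed.

(** The points used against an interval: all those of a block if the interval is
    good, else one out of [kap], which prevents clusters of hits. *)
Definition step (kap : nat) (al be : R) : nat :=
  if `[< good S%:R al be >] then 1 else kap.

Definition some_miss (kap u : nat) : bool :=
  has (fun i => let al := i%:R * N%:R^-1 in let be := al + L in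
    (be <= 1) && unhit (bQ A W)
      (block_hit A W al be (step kap al be) (M0 %/ step kap al be)) B u)
    (iota 0 N).

Lemma avg_some_miss_le kap : (0 < N)%N -> (S < 2 ^ kap)%N -> (0 < kap)%N ->
    (1 - eta) * W%:R <= M0%:R ->
    (1 - eta) * (W%:R / kap%:R) <= (M0 %/ kap)%:R ->
  avg (bP A W B) (fun u => (some_miss kap u)%:R) <=
  N%:R * expR (- ((1 - 8 * eta) * (N%:R * L)))
  + S.+1%:R * (S%:R * (3 * (N%:R * L) + 1))
    * expR (- ((1 - 8 * eta) * (N%:R * L / kap%:R))).
Proof.
move=> N0 Skap kap0 M1 Mk; have N0' : 0 < N%:R :> R by rewrite ltr0n.
set e1 := expR _; set e2 := expR _.
have e10 : 0 <= e1 by exact: expR_ge0.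
have e20 : 0 <= e2 by exact: expR_ge0.
pose al i : R := i%:R * N%:R^-1; pose be i : R := al i + L.
pose ev i u : R := ((be i <= 1) && unhit (bQ A W)
  (block_hit A W (al i) (be i) (step kap (al i) (be i))
    (M0 %/ step kap (al i) (be i))) B u)%:R.
apply: (@le_trans _ _ (avg (bP A W B) (fun u => \sum_(i <- iota 0 N) ev i u))).
  by apply: le_avg => u _; exact: has_le_sum.
rewrite avg_sum.
apply: (@le_trans _ _ (\sum_(0 <= i < N) (e1
   + (~~ `[< good S%:R (al i) (be i) >] && (be i <= 1))%R%:R * e2))).
  rewrite /index_iota subn0; apply: ler_sum => i _.
  rewrite /ev; case: (boolP (be i <= 1)) => /= b1; last first.
    rewrite (eq_avg (g := fun=> 0)) ?avg_cst ?bP_gt0// andbF mul0r addr0//.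
  have a0 : 0 <= al i by rewrite mulr_ge0// invr_ge0 ltW.
  have UA := unhit_avg_le A_gt0 A_dvd A_double M0W L_gt0 eta_le tauL WL S_gt0 Seta.
  rewrite andbT /step; case: asboolP => gd /=.
    rewrite mul0r addr0 divn1 /e1.
    apply: le_trans (UA _ _ _ _ a0 b1 _ _ _ _) _ => //.
    - by rewrite mul1n.
    - by rewrite divr1.
    - by left.
    - by rewrite divr1.
  rewrite mul1r; apply: ler_wpDl => //.
  apply: le_trans (UA _ _ _ _ a0 b1 _ _ _ _) _ => //.
  - by rewrite mulnC leq_trunc_div.
  - by right.
rewrite big_split/= sumr_const_nat subn0 -[e1 *+ N]mulr_natl lerD2l.
rewrite -mulr_suml ler_wpM2r//.
have := @sum_not_good_le R S L L_gt0 N%:R^-1 N.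
by rewrite invr_gt0 invrK [L * _]mulrC; exact.
Qed.

(** A long arc which does not contain 0 contains an interval of the grid; a long
    arc around 0 contains one of the two half-length intervals next to 0. *)
Lemma max_gap_le_of_hits (a : nat -> nat) (x : circle R) :
    (forall n, A n = a n.+1) -> (0 < N)%N ->
    (forall i, (i < N)%N -> i%:R * N%:R^-1 + L <= 1 ->
       exists2 n, (n < N)%N & i%:R * N%:R^-1 <= crep (x *+ A n)
         < i%:R * N%:R^-1 + L + tau) ->
    (exists2 n, (n < N)%N & crep (x *+ A n) < L / 2 + tau) ->
    (exists2 n, (n < N)%N & 1 - L / 2 <= crep (x *+ A n)) ->
  max_gap a N x <= L + 2 / N%:R + 2 * tau.
Proof.
move=> Aa N0 hits hit0 hit1.
have L0 := L_gt0; have t0 := tau_ge0.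
have N0' : 0 < N%:R :> R by rewrite ltr0n.
have iN0 : 0 < N%:R^-1 :> R by rewrite invr_gt0.
apply: max_gap_le => [|p q p0 p1 pq]; first lra.
have [q1|q1] := leP q 1.
  (* the first grid point to the right of [p] *)
  pose i := (Num.truncn (p * N%:R)).+1.
  have /andP[i1 i2] := @truncn_itv _ (p * N%:R) ltac:(by rewrite mulr_ge0// ltW).
  have {}i1 : i%:R * N%:R^-1 <= p + N%:R^-1.
    by rewrite /i -natr1 mulrDl mul1r lerD2r ler_pdivrMr.
  have {}i2 : p < i%:R * N%:R^-1 by rewrite ltr_pdivlMr.
  have iL : i%:R * N%:R^-1 + L <= 1 by lra.
  have iN : (i < N)%N.
    by rewrite -(ltr_nat R) -[ltRHS]mul1r -ltr_pdivrMr//; lra.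
  have [n nN /andP[h1 h2]] := hits i iN iL.
  exists n.+1, (crep (x *+ A n)); rewrite -Aa crepK; split => //.
  by apply/andP; split; lra.
have [pL|pL] := leP p (1 - L / 2).
  have [n nN h] := hit1; exists n.+1, (crep (x *+ A n)).
  have := crep_lt1 (x *+ A n); rewrite -Aa crepK; split => //.
  by apply/andP; split; lra.
have [n nN h] := hit0; exists n.+1, (crep (x *+ A n) + 1%:~R).
have := crep_ge0 (x *+ A n); rewrite -Aa circle_pi_addz crepK; split => //.
by apply/andP; split; lra.
Qed.

(** The candidates for a gap are the disjoint cells [i * L, i * L + L[. *)
Let K0 := Num.truncn L^-1.
Let al (i : 'I_K0) : R := i%:R * L.
Definition good_cell : pred 'I_K0 :=
  fun i => `[< good S%:R (al i) (al i + L) >].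

Let cell_unhit (i : 'I_K0) (u : nat) : bool :=
  unhit (bQ A W) (block_hit A W (al i) (al i + L) 1 M0) B.+1 u.
Let cell_straddle (i : 'I_K0) (u : nat) : bool :=
  straddle (bQ A W) (gap_hit A W M0 (al i) (al i + L)) B.+1 u.

Definition no_survivor (u : nat) : bool :=
  [forall i in good_cell, cell_unhit i u ==> cell_straddle i u].

Let al_ge0 i : 0 <= al i.
Proof. by rewrite mulr_ge0// ltW. Qed.

Let al_le1 i : al i + L <= 1.
Proof.
have i1 : (i < K0)%N by [].
have : i.+1%:R <= L^-1 :> R.
  apply: (@le_trans _ _ K0%:R); first by rewrite ler_nat.
  by rewrite truncn_le invr_ge0 ltW.
by rewrite -natr1 -[leRHS]mul1r ler_pdivlMr// mulrDl mul1r.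
Qed.

Lemma card_good_cell_ge : 1 + S.+1%:R * (S%:R * 4) <= (2 * L)^-1 ->
  (2 * L)^-1 <= #|good_cell|%:R.
Proof.
move=> Lsmall.
have KL : L^-1 < K0%:R + 1 by rewrite natr1 truncnS_gt.
have bad : \sum_(0 <= i < K0) (~~ `[< good S%:R (i%:R * L) (i%:R * L + L) >]
      && (i%:R * L + L <= 1))%R%:R <= S.+1%:R * (S%:R * 4) :> R.
  apply: le_trans (sum_not_good_le S L_gt0 _ L_gt0) _.
  by rewrite divff ?gt_eqF//; lra.
have : K0%:R = #|good_cell|%:R + \sum_(0 <= i < K0)
    (~~ `[< good S%:R (i%:R * L) (i%:R * L + L) >]
      && (i%:R * L + L <= 1))%R%:R :> R.
  rewrite big_mkord -sum1_card natr_sum big_mkcond/= -big_split/=.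
  rewrite -{1}[K0]card_ord -sum1_card natr_sum; apply: eq_bigr => i _.
  rewrite (al_le1 i) andbT /good_cell unfold_in.
  by case: `[< _ >]; rewrite /= ?addr0 ?add0r.
have -> : (2 * L)^-1 = L^-1 / 2 by rewrite invfM mulrC.
move: Lsmall; have -> : (2 * L)^-1 = L^-1 / 2 by rewrite invfM mulrC.
lra.
Qed.

Lemma expR_le_1B (z : R) : 0 <= z -> z <= 1 / 2 ->
  expR (- (z * (1 + 2 * z))) <= 1 - z.
Proof.
move=> z0 z1; have z2 : 0 < 1 - z by lra.
rewrite expRN -[leRHS]invrK lef_pV2 ?posrE ?expR_gt0 ?invr_gt0//.
apply: le_trans (expR_ge1Dx _); rewrite -[leLHS]mul1r ler_pdivrMr//.
have : 0 <= z * z * (1 - 2 * z) by rewrite !mulr_ge0//; lra.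
lra.
Qed.

(** The main points of the blocks leave [#|good_cell| * r ^ B.+1] cells on
    average, with exponential concentration. The points near the ends of the
    blocks straddle two blocks and are not covered by the independence argument;
    being few, they spoil only a small proportion of these cells, on average. *)
Lemma avg_no_survivor_le : (0 < W)%N -> 1 + S.+1%:R * (S%:R * 4) <= (2 * L)^-1 ->
    W%:R <= eta * N%:R -> (1 - eta) * W%:R <= M0%:R -> 0 < eta ->
  avg (bP A W B.+1) (fun u => (no_survivor u)%:R) <=
  expR (- (eta / W%:R * (expR (- ((1 + 32 * eta) * (N%:R * L))) * (4 * L)^-1)))
  + 2 * (B%:R * ((W - M0)%:R * (L + tau)))
    * (expR (- ((1 - 9 * eta) * (N%:R * L)))
       / expR (- ((1 + 32 * eta) * (N%:R * L)))).
Proof.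
move=> W0 Lsmall WN M1 eta0; have W0' : 0 < W%:R :> R by rewrite ltr0n.
have L0 := L_gt0; have t0 := tau_ge0; have e1 := eta_le; have tL := tauL.
have NE : N%:R = B%:R * W%:R :> R by rewrite natrM.
set E1 := expR (- ((1 + 32 * _) * _)); set E2 := expR (- ((1 - 9 * _) * _)).
have E10 : 0 < E1 by exact: expR_gt0.
pose p : R := W%:R * (L + tau); pose r := 1 - p * (1 + 2 * eta).
pose z := p * (1 + 2 * eta).
have p0 : 0 <= p by rewrite mulr_ge0// ?addr_ge0// ltW.
have ple : p <= W%:R * L * (1 + eta).
  by rewrite /p -mulrA; apply: ler_wpM2l; [exact: ltW|lra].
have z0 : 0 <= z by rewrite mulr_ge0//; lra.
have zle : z <= W%:R * L * ((1 + eta) * (1 + 2 * eta)).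
  by rewrite /z mulrA ler_wpM2r//; lra.
have c2 : (1 + eta) * (1 + 2 * eta) <= 2 by nra.
have z2 : z <= 2 * eta.
  apply: le_trans zle _; rewrite mulrC; apply: ler_pM => //.
    by rewrite mulr_ge0//; lra.
  by rewrite mulr_ge0// ltW.
have rz : r = 1 - z by [].
have rE1 : E1 <= r ^+ B.+1.
  apply: (@le_trans _ _ (expR (- (z * (1 + 2 * z))) ^+ B.+1)).
    rewrite -expRM_natr ler_expR mulNr lerN2.
    have BW : B.+1%:R * W%:R <= (1 + eta) * N%:R.
      by rewrite -natr1 NE mulrDl mul1r -NE; lra.
    apply: (@le_trans _ _ (W%:R * L * ((1 + eta) * (1 + 2 * eta)) * (1 + 4 * eta)
      * B.+1%:R)).
      rewrite ler_wpM2r//; apply: ler_pM => //; lra.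
    have -> : W%:R * L * ((1 + eta) * (1 + 2 * eta)) * (1 + 4 * eta) * B.+1%:R =
      B.+1%:R * W%:R * (L * (((1 + eta) * (1 + 2 * eta)) * (1 + 4 * eta))) by ring.
    apply: (@le_trans _ _ ((1 + eta) * N%:R *
        (L * (((1 + eta) * (1 + 2 * eta)) * (1 + 4 * eta))))).
      by apply: ler_wpM2r => //; apply: mulr_ge0; [exact: ltW|rewrite !mulr_ge0//; lra].
    have -> : (1 + eta) * N%:R *
        (L * (((1 + eta) * (1 + 2 * eta)) * (1 + 4 * eta))) =
      (1 + eta) * ((1 + eta) * (1 + 2 * eta) * (1 + 4 * eta)) * (N%:R * L) by ring.
    rewrite ler_wpM2r//; first by rewrite mulr_ge0// ltW.
    have h1 : (1 + eta) * (1 + eta) <= 1 + 3 * eta by nra.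
    have h2 : (1 + 2 * eta) * (1 + 4 * eta) <= 1 + 7 * eta by nra.
    have -> : (1 + eta) * ((1 + eta) * (1 + 2 * eta) * (1 + 4 * eta)) =
      ((1 + eta) * (1 + eta)) * ((1 + 2 * eta) * (1 + 4 * eta)) by ring.
    apply: (@le_trans _ _ ((1 + 3 * eta) * (1 + 7 * eta))); last by nra.
    by apply: ler_pM => //; rewrite mulr_ge0//; lra.
  rewrite rz; apply: lerXn2r; rewrite ?nnegrE ?expR_ge0//; first lra.
  by apply: expR_le_1B => //; lra.
have rB0 : 0 < r ^+ B.+1 by exact: lt_le_trans rE1.
pose lam := eta / W%:R.
have lam0 : 0 <= lam by rewrite divr_ge0// ltW.
pose cC : R := #|good_cell|%:R.
have cCge : (2 * L)^-1 <= cC by exact: card_good_cell_ge.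
have cC0 : 0 < cC by apply: lt_le_trans cCge; rewrite invr_gt0 mulr_gt0.
(* half of the lower bound for the expected number of missed cells *)
pose u0 := r ^+ B.+1 * cC / 2.
have u00 : 0 < u0 by rewrite divr_gt0// mulr_gt0.
pose U u : R := \sum_(i in good_cell) (cell_unhit i u)%:R.
pose Y u : R := \sum_(i in good_cell) (cell_unhit i u && cell_straddle i u)%:R.
apply: (@le_trans _ _ (avg (bP A W B.+1) (fun u =>
    expR (lam * u0) * expR (- lam * U u) + Y u / u0))).
  apply: le_avg => u _; have Y0 : 0 <= Y u by apply: sumr_ge0.
  case: (boolP (no_survivor u)) => /= ns; last first.
    apply: addr_ge0; first by rewrite mulr_ge0 ?expR_ge0.
    by apply: divr_ge0 => //; exact: ltW.
  (* If nothing survives, every cell missed by the main points is hit by a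
     straddling one: either few cells are missed, which the exponential moment
     controls, or [Y] is large, which Markov's inequality controls. *)
  have UY : U u <= Y u.
    apply: ler_sum => i iC; move/forall_inP : ns => /(_ i iC).
    by case: (cell_unhit i u) => //= ->.
  have [Uu|Uu] := leP (U u) u0.
    rewrite -expRD mulNr -mulrBr; apply: (@le_trans _ _ (1 + 0)).
      by rewrite addr0.
    apply: lerD; last by rewrite divr_ge0// ltW.
    apply: le_trans (expR_ge1Dx _); rewrite lerDl.
    by apply: mulr_ge0 => //; rewrite subr_ge0.
  apply: (@le_trans _ _ (0 + 1)); first by rewrite add0r.
  apply: lerD; first by rewrite mulr_ge0 ?expR_ge0.
  by rewrite ler_pdivlMr// mul1r; lra.
rewrite avgD avgZ avgZr.
have PQ0 := @bQ_gt0 A A_gt0 A_dvd W.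
have al_lt i : al i <= al i + L by rewrite lerDl ltW.
have LE i : al i + L - al i = L by ring.
apply: lerD.
  apply: (@le_trans _ _ (expR (lam * u0) * expR (- lam * (r ^+ B.+1 * cC)))).
    rewrite ler_wpM2l ?expR_ge0//.
    have H := @avg_exp_survivors_le R (bP A W) (bQ A W) PQ0 (bP_gt0 A_gt0 W)
      (bPS A_dvd W) 'I_K0 good_cell
      (fun i => block_hit A W (al i) (al i + L) 1 M0) W%:R p eta lam B.+1.
    apply: H => //.
    - by rewrite /lam divfK// gt_eqF.
    - lra.
    - by rewrite -/z; lra.
    - move=> b v bB vQ; apply: (@le_trans _ _ M0%:R); last by rewrite ler_nat.
      apply: (sum_block_hit_le A_gt0 A_dvd M0W b v _ (leqnn M0)).
      move=> i j y _ _ /andP[i1 i2] /andP[j1 j2].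
      have lt_of (i' j' : 'I_K0) : al i' <= y -> y < al j' + L -> (i' <= j')%N.
        move=> h1 h2; rewrite -ltnS -(ltr_nat R) -(ltr_pM2r L0).
        by rewrite -natr1 mulrDl mul1r; exact: le_lt_trans h1 h2.
      by apply/val_inj/eqP; rewrite eqn_leq /= !lt_of.
    - move=> b i bB iC.
      apply: le_trans (block_hit_le A_gt0 A_dvd A_double M0W b (al_lt i) (leqnn _)) _.
      by rewrite LE -/tau /p ler_wpM2r ?ler_nat// addr_ge0// ltW.
  rewrite -expRD ler_expR mulNr -lerBrDl -opprB opprK /u0 -/lam.
  have : E1 * (2 * L)^-1 <= r ^+ B.+1 * cC.
    by apply: ler_pM => //; [exact: ltW|rewrite invr_ge0 mulr_ge0// ltW].
  have -> : (4 * L)^-1 = (2 * L)^-1 / 2 by rewrite !invfM; field; rewrite gt_eqF.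
  move=> /(ler_wpM2l lam0); lra.
pose gam : R := (W - M0)%:R * (L + tau).
have gam0 : 0 <= gam by rewrite mulr_ge0// addr_ge0// ltW.
pose rho : R := 1 - (1 - 8 * eta) * (W%:R * L / 1%:R).
have miss i b : i \in good_cell -> avg (bQ A W b) (fun v =>
    (~~ block_hit A W (al i) (al i + L) 1 M0 b v)%:R) <= rho.
  move=> iC; apply: (block_miss_le A_gt0 A_dvd A_double M0W L_gt0 eta_le tauL WL S_gt0 Seta) => //.
  - by rewrite mul1n.
  - by rewrite divr1.
  - by left; exact/asboolP.
have rho_ge0 : 0 <= rho.
  rewrite /rho divr1; have WLe := WL.
  have : 0 <= W%:R * L by rewrite mulr_ge0// ltW.
  nra.
have rhoE2 : rho ^+ B.-1 <= E2.
  apply: (@le_trans _ _ (expR (- ((1 - 8 * eta) * (W%:R * L))) ^+ B.-1)).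
    rewrite /rho divr1; apply: lerXn2r; rewrite ?nnegrE ?expR_ge0//.
      by move: rho_ge0; rewrite /rho divr1.
    exact: expR_ge1Dx.
  rewrite -expRM_natr ler_expR mulNr lerN2.
  have BW : (1 - eta) * N%:R <= W%:R * B.-1%:R.
    have : B%:R - 1 <= B.-1%:R :> R.
      by case: (B) => [|B'] /=; rewrite -?natr1; lra.
    move=> /(ler_wpM2l (ltW W0')); rewrite mulrBr mulr1 [W%:R * B%:R]mulrC -NE.
    lra.
  apply: (@le_trans _ _ ((1 - 8 * eta) * (1 - eta) * (N%:R * L))).
    by apply: ler_wpM2r; [rewrite mulr_ge0// ltW|nra].
  have -> : (1 - 8 * eta) * (1 - eta) * (N%:R * L) =
    (1 - 8 * eta) * L * ((1 - eta) * N%:R) by ring.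
  have -> : (1 - 8 * eta) * (W%:R * L) * B.-1%:R =
    (1 - 8 * eta) * L * (W%:R * B.-1%:R) by ring.
  by apply: ler_wpM2l => //; apply: mulr_ge0; [lra|exact: ltW].
have Yle : avg (bP A W B.+1) Y <= cC * (B%:R * gam * rho ^+ B.-1).
  rewrite /Y avg_sum /cC mulr_natl -sumr_const; apply: ler_sum => i iC.
  apply: (avg_unhit_straddle_le PQ0 (bP_gt0 A_gt0 W) (bPS A_dvd W)) => //.
    by move=> b _; exact: miss.
  move=> b _; apply: le_trans (gap_hit_le A_gt0 A_dvd A_double M0W b (al_lt i)) _.
  by rewrite LE.
apply: (@le_trans _ _ (cC * (B%:R * gam * rho ^+ B.-1) / u0)).
  by rewrite ler_wpM2r// invr_ge0 ltW.
have -> : cC * (B%:R * gam * rho ^+ B.-1) / u0 =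
    2 * (B%:R * gam) * (rho ^+ B.-1 / r ^+ B.+1).
  by rewrite /u0; field; rewrite ?gt_eqF.
apply: ler_wpM2l; first by apply: mulr_ge0 => //; exact: mulr_ge0.
apply: ler_pM => //.
- exact: exprn_ge0.
- by rewrite invr_ge0 ltW.
- by rewrite lef_pV2.
Qed.

(** A surviving cell contains an arc free of points, up to the loss [tau]. *)
Lemma max_gap_ge_of_survivor (a : nat -> nat) (x : circle R) :
    (forall n, A n = a n.+1) -> (0 < W)%N ->
    ~~ no_survivor (digits (bP A W B.+1) x) ->
  L - tau <= max_gap a N x.
Proof.
move=> Aa W0 /forall_inPn[i iC]; rewrite negb_imply => /andP[ui si].
have a0 := al_ge0 i; have a1 := al_le1 i; have t0 := tau_ge0.
have e1 := eta_le; have tL := tauL; have L0 := L_gt0.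
have tL' : tau <= L by apply: le_trans tL _; rewrite ler_piMl//; lra.
have -> : L - tau = al i + L - (al i + tau) by ring.
apply: max_gap_ge; [lra|lra|lra|] => -[//|n] /andP[_ nN]; rewrite -Aa.
exact: (orbit_avoid A_gt0 A_dvd A_double M0W W0 ui si).
Qed.

End Events.

(** * Choice of the scales *)

Section Asymptotics.
Variable R : realType.
Implicit Types (C c eta eps : R) (d k : nat).
Local Notation lnk k := (ln (k%:R : R)).

Lemma near_ln_ge C : \forall k \near \oo, C <= lnk k.
Proof.
near=> k; have kC : expR C <= k%:R by near: k; exact: nbhs_infty_ger.
by rewrite -[C]expRK ler_ln ?posrE ?expR_gt0//; apply: lt_le_trans kC; exact: expR_gt0.
Unshelve. all: by end_near. Qed.

Lemma near_ln_le C : \forall k \near \oo, C * lnk k <= k%:R.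
Proof.
near=> k; have lC : 2 * C <= lnk k by near: k; exact: near_ln_ge.
have l0 : 0 <= lnk k by near: k; exact: near_ln_ge.
have k0 : (0 < k)%N by near: k; exact: nbhs_infty_gt.
have := expR_ge1Dxn 1 l0; rewrite lnK ?posrE ?ltr0n// (_ : 2`!%:R = 2)//.
nra.
Unshelve. all: by end_near. Qed.

Lemma expR_ln_nat k n : (0 < k)%N -> (k ^ n)%:R = expR (n%:R * lnk k).
Proof. by move=> k0; rewrite mulrC expRM_natr lnK ?posrE ?ltr0n// natrX. Qed.

Lemma near_exp2_ge C d : \forall k \near \oo, C * (k ^ d)%:R <= (2 ^ k)%:R :> R.
Proof.
have ln2 : 0 < ln 2 :> R by rewrite ln_gt0// ltr1n.
near=> k; have k0 : (0 < k)%N by near: k; exact: nbhs_infty_gt.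
have k0' : 0 < k%:R :> R by rewrite ltr0n.
have Ck : C <= k%:R by near: k; exact: nbhs_infty_ger.
apply: (@le_trans _ _ (k ^ d.+1)%:R).
  by rewrite expnS natrM ler_wpM2r.
rewrite !expR_ln_nat// ler_expR -ler_pdivrMr// mulrAC.
by near: k; exact: near_ln_le.
Unshelve. all: by end_near. Qed.

End Asymptotics.

Section Regime.
Variable R : realType.
Implicit Types (c eta : R) (d k : nat).
Local Notation lnk k := (ln (k%:R : R)).

(** This is [c * ln N / N] for [N = k ^ d], the number of points at scale [k].
    They form blocks of [k ^ 5] points, the last [k] of which are set apart: the
    gap of [k] makes the truncation error [2 ^- k] negligible, and the exponent
    [5] makes the set apart points rare enough for a summable bound. *)
Definition scale_len c d k : R := c * (d%:R * lnk k) / (k ^ d)%:R.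

Lemma scale_pointsE d k : (7 <= d)%N -> (k ^ (d - 5) * k ^ 5)%N = (k ^ d)%N.
Proof. by move=> d_ge7; rewrite -expnD; congr (k ^ _)%N; lia. Qed.

Lemma scale_gapE k : (0 < k)%N -> (k ^ 5 - (k ^ 5 - k) = k)%N.
Proof. by move=> k0; rewrite subKn// -{1}[k]expn1 leq_pexp2l. Qed.

Lemma scale_len_gt0 c d k : 0 < c -> (7 <= d)%N -> (1 < k)%N ->
  0 < scale_len c d k.
Proof.
move=> c_gt0 d_ge7 k1; have d0 : (0 < d)%N by apply: leq_trans d_ge7.
by rewrite divr_gt0 ?mulr_gt0 ?ltr0n ?expn_gt0 ?(ltnW k1)// ln_gt0// ltr1n.
Qed.

Lemma scale_mulN c d k : (0 < k)%N ->
  (k ^ d)%:R * scale_len c d k = c * (d%:R * lnk k).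
Proof. by move=> k0; rewrite mulrC divfK// pnatr_eq0 expn_eq0 negb_and -lt0n k0. Qed.

Lemma near_scale_tau c eta d : 0 < c -> 0 < eta -> (7 <= d)%N ->
  \forall k \near \oo, (2 ^ k)%:R^-1 <= eta * scale_len c d k.
Proof.
move=> c_gt0 eta_gt0 d_ge7; have d0 : 0 < d%:R :> R by rewrite ltr0n; apply: leq_trans d_ge7.
near=> k; have k0 : (0 < k)%N by near: k; exact: nbhs_infty_gt.
have l1 : 1 <= lnk k by near: k; exact: near_ln_ge.
have kd : 0 < (k ^ d)%:R :> R by rewrite ltr0n expn_gt0 k0.
have k2 : 0 < (2 ^ k)%:R :> R by rewrite ltr0n expn_gt0.
have h : (eta * (c * d%:R))^-1 * (k ^ d)%:R <= (2 ^ k)%:R.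
  by near: k; exact: near_exp2_ge.
have ecd : 0 < eta * (c * d%:R) by rewrite !mulr_gt0.
rewrite /scale_len mulrA ler_pdivlMr// mulrC ler_pdivrMr//.
move: h; rewrite mulrC ler_pdivrMr// => h.
apply: (le_trans h); have -> : eta * (c * (d%:R * lnk k)) * (2 ^ k)%:R =
  (2 ^ k)%:R * (eta * (c * d%:R)) * lnk k by ring.
by rewrite ler_peMr// ltW// mulr_gt0.
Unshelve. all: by end_near. Qed.

Lemma near_scale_block c eta d : 0 < c -> 0 < eta -> (7 <= d)%N ->
  \forall k \near \oo, (k ^ 5)%:R * scale_len c d k <= eta.
Proof.
move=> c_gt0 eta_gt0 d_ge7; near=> k; have k0 : (0 < k)%N by near: k; exact: nbhs_infty_gt.
have k1 : 1 <= k%:R :> R by rewrite ler1n.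
have kd : 0 < (k ^ d)%:R :> R by rewrite ltr0n expn_gt0 k0.
have h : (c * d%:R) / eta * lnk k <= k%:R by near: k; exact: near_ln_le.
have dE : d = (5 + (d - 5))%N by lia.
have k5 : 0 < (k ^ 5)%:R :> R by rewrite ltr0n expn_gt0 k0.
rewrite /scale_len mulrA ler_pdivrMr// [in leRHS]dE expnD natrM.
rewrite [leRHS]mulrCA ler_pM2l// -ler_pdivrMl//.
have -> : eta^-1 * (c * (d%:R * lnk k)) = c * d%:R / eta * lnk k by ring.
apply: (le_trans h).
by rewrite ler_nat -{1}[k]expn1 leq_pexp2l//; lia.
Unshelve. all: by end_near. Qed.

Lemma near_scale_small c d C : 0 < c -> (7 <= d)%N ->
  \forall k \near \oo, C <= (2 * scale_len c d k)^-1.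
Proof.
move=> c_gt0 d_ge7; near=> k; have k2 : (1 < k)%N by near: k; exact: nbhs_infty_gt.
have L0 := scale_len_gt0 c_gt0 d_ge7 k2.
have kd : 0 < (k ^ d)%:R :> R by rewrite ltr0n expn_gt0 ltnW.
have h : (`|C| * 2 * c * d%:R) * lnk k <= k%:R by near: k; exact: near_ln_le.
have L2 : 0 < 2 * scale_len c d k by rewrite pmulr_rgt0.
rewrite -[leRHS]mul1r ler_pdivlMr//.
apply: (@le_trans _ _ (`|C| * (2 * scale_len c d k))).
  by apply: ler_wpM2r; [exact: ltW|exact: ler_norm].
rewrite /scale_len !mulrA ler_pdivrMr// mul1r.
apply: (le_trans h); rewrite ler_nat -{1}[k]expn1 leq_pexp2l ?(ltnW k2)//.
by lia.
Unshelve. all: by end_near. Qed.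

Lemma near_scale_count eta d : 0 < eta -> (7 <= d)%N ->
  \forall k \near \oo, (k ^ 5)%:R <= eta * (k ^ d)%:R.
Proof.
move=> eta_gt0 d_ge7; near=> k; have k0 : (0 < k)%N by near: k; exact: nbhs_infty_gt.
have h : eta^-1 <= k%:R by near: k; exact: nbhs_infty_ger.
have -> : (k ^ d)%:R = (k ^ 5)%:R * k%:R * (k ^ (d - 6))%:R :> R.
  by rewrite -!natrM -expnSr -expnD; congr (k ^ _)%:R; lia.
have k5 : 0 < (k ^ 5)%:R :> R by rewrite ltr0n expn_gt0 k0.
have k6 : 1 <= (k ^ (d - 6))%:R :> R by rewrite ler1n expn_gt0 k0.
have {}h : 1 <= eta * k%:R by rewrite mulrC -ler_pdivrMr// div1r.
have -> : eta * ((k ^ 5)%:R * k%:R * (k ^ (d - 6))%:R) =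
  (k ^ 5)%:R * ((eta * k%:R) * (k ^ (d - 6))%:R) by ring.
by apply: ler_peMr; [exact: ltW|exact: mulr_ege1].
Unshelve. all: by end_near. Qed.

Lemma near_scale_step eta kap : 0 < eta -> (0 < kap)%N -> eta <= 1 ->
  \forall k \near \oo,
    (1 - eta) * ((k ^ 5)%:R / kap%:R) <= ((k ^ 5 - k) %/ kap)%:R.
Proof.
move=> eta_gt0 kap0 eta1; near=> k; have k0 : (0 < k)%N by near: k; exact: nbhs_infty_gt.
have kk : (kap <= k)%N by near: k; exact: nbhs_infty_ge.
have h : 2 / eta <= k%:R by near: k; exact: nbhs_infty_ger.
have kap0' : 0 < kap%:R :> R by rewrite ltr0n.
have lek : (k <= k ^ 5)%N by rewrite -{1}[k]expn1 leq_pexp2l.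
rewrite mulrA ler_pdivrMr//.
have h1 : (k ^ 5 - k)%:R <= ((k ^ 5 - k) %/ kap)%:R * kap%:R + kap%:R :> R.
  rewrite -natrM -natrD ler_nat {1}(divn_eq (k ^ 5 - k) kap) leq_add2l.
  by rewrite ltnW// ltn_pmod.
rewrite natrB// in h1.
have h2 : kap%:R <= k%:R :> R by rewrite ler_nat.
have h3 : 2 <= eta * k%:R by rewrite mulrC -ler_pdivrMr.
have h4 : 2 * k%:R <= eta * (k ^ 5)%:R.
  apply: (@le_trans _ _ (eta * k%:R * k%:R)); first by rewrite ler_wpM2r.
  rewrite -mulrA ler_pM2l// -natrM ler_nat -{1 2}[k]expn1 -expnD leq_pexp2l//.
lra.
Unshelve. all: by end_near. Qed.

End Regime.

Definition doubling_chain (A : nat -> nat) : Prop :=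
  [/\ forall n, (0 < A n)%N, forall n, (A n %| A n.+1)%N
    & forall n, (2 * A n <= A n.+1)%N].

Section Scales.
Variable R : realType.
Implicit Types (a : nat -> nat) (eps : R) (d k : nat).
Local Notation lnk k := (ln (k%:R : R)).

Lemma avg_or_le T (E F : pred nat) :
  avg T (fun u => (E u || F u)%:R) <=
  avg T (fun u => (E u)%:R) + avg T (fun u => (F u)%:R) :> R.
Proof.
rewrite -avgD; apply: le_avg => u _.
by case: (E u); case: (F u); rewrite /= ?addr0 ?add0r// lerDl.
Qed.

Lemma expR_le_invXn k n (z : R) : (0 < k)%N -> z <= - (n%:R * lnk k) ->
  expR z <= (k%:R ^+ n)^-1.
Proof.
move=> k0 zk; apply: (@le_trans _ _ (expR (- (n%:R * lnk k)))).
  by rewrite ler_expR.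
by rewrite expRN -natrX (expR_ln_nat _ n k0).
Qed.

Lemma upper_arith (N X L tau eta c eps G : R) :
    0 < N -> 0 <= X -> N * L = c * X -> tau <= eta * L ->
    G <= L + 2 / N + 2 * tau -> (1 + 2 * eta) * c <= 1 + (1 + 1 / 4) * eps ->
    8 <= eps * X ->
  N * G <= (1 + 2 * eps) * X.
Proof.
move=> N0 X0 NL tL GL hc eX.
apply: (@le_trans _ _ (N * (L + 2 / N + 2 * (eta * L)))).
  by rewrite ler_pM2l//; lra.
have -> : N * (L + 2 / N + 2 * (eta * L)) = (1 + 2 * eta) * (N * L) + 2.
  by field; rewrite gt_eqF.
rewrite NL mulrA; have := ler_wpM2r X0 hc; lra.
Qed.

(** The union bound over the grid gains the factor
    [k ^ (d * (1 - (1 + eps) * (1 - eps / 4)))], a negative power. The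
    [O(ln N)] bad positions only give the power [- d / kap] with the subsampling
    step [kap = S]; therefore [d] is chosen after [eta] and [S]. *)
Lemma upper_scale a eps : doubling_chain (fun n => a n.+1) ->
    0 < eps -> eps <= 1 ->
  exists2 d, (0 < d)%N & \forall k \near \oo, exists T (E : pred nat),
    [/\ (0 < T)%N, avg T (fun u => (E u)%:R) <= 4 / k%:R ^+ 2 :> R
      & forall x : circle R, ~~ E (digits T x) ->
          (k ^ d)%:R * max_gap a (k ^ d) x / ln (k ^ d)%:R <= 1 + 2 * eps].
Proof.
set A := fun n : nat => a n.+1; move=> [A_gt0 A_dvd A_double] e0 e1.
pose eta : R := eps / 32.
have eta0 : 0 < eta by rewrite divr_gt0.
have eta16 : eta <= 1 / 16 by rewrite /eta; lra.
pose S := (Num.truncn (2 / eta)).+1.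
have S0 : (0 < S)%N by [].
have Seta : 2 / S%:R <= eta.
  rewrite ler_pdivrMr ?ltr0n// mulrC -ler_pdivrMr//.
  by rewrite ltW// /S truncnS_gt.
have SS : (S < 2 ^ S)%N by rewrite ltn_expl.
pose d := (4 * S + (7 + (Num.truncn (4 / eps)).+1))%N.
have d7 : (7 <= d)%N by rewrite /d; lia.
have d0 : 0 < d%:R :> R by rewrite ltr0n; lia.
have deps : 4 <= d%:R * eps.
  rewrite -ler_pdivrMr//; apply: (@le_trans _ _ (Num.truncn (4 / eps)).+1%:R).
    by rewrite ltW// truncnS_gt.
  by rewrite ler_nat /d; lia.
have dS : 4 * S%:R <= d%:R :> R by rewrite -natrM ler_nat /d; lia.
pose c : R := 1 + eps.
have c0 : 0 < c by rewrite /c; lra.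
have c20 : 0 < c / 2 by rewrite divr_gt0.
have c1 : 1 <= (1 - 8 * eta) * c.
  rewrite /c /eta; have : 0 <= eps * (1 - eps) by rewrite mulr_ge0//; lra.
  lra.
have c2 : eps / 2 <= (1 - 8 * eta) * c - 1.
  rewrite /c /eta; have : 0 <= eps * (1 - eps) by rewrite mulr_ge0//; lra.
  lra.
have c3 : (1 + 2 * eta) * c <= 1 + (1 + 1 / 4) * eps.
  have : 0 <= eps * (1 - eps) by rewrite mulr_ge0//; lra.
  by rewrite /c /eta; lra.
exists d; first exact: leq_trans d7.
near=> k.
have k1 : (1 < k)%N by near: k; exact: nbhs_infty_gt.
have k0 : (0 < k)%N by exact: ltnW.
have lk1 : 8 / eps <= lnk k by near: k; exact: near_ln_ge.
have l1 : 1 <= lnk k by near: k; exact: near_ln_ge.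
have l0 : 0 <= lnk k by apply: le_trans l1.
have dl_ge0 : 0 <= d%:R * lnk k by rewrite mulr_ge0// ltW.
have poly : S.+1%:R * (S%:R * (3 * c * d%:R + 1)) * lnk k <= k%:R.
  by near: k; exact: near_ln_le.
have T1 : (2 ^ k)%:R^-1 <= eta * scale_len c d k by near: k; exact: near_scale_tau.
have T2 : (2 ^ k)%:R^-1 <= eta * scale_len (c / 2) d k.
  by near: k; exact: near_scale_tau.
have W1 : (k ^ 5)%:R * scale_len c d k <= eta by near: k; exact: near_scale_block.
have W2 : (k ^ 5)%:R * scale_len (c / 2) d k <= eta.
  by near: k; exact: near_scale_block.
have M1 : (1 - eta) * ((k ^ 5)%:R / 1%:R) <= ((k ^ 5 - k) %/ 1)%:R.
  by near: k; apply: near_scale_step => //; lra.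
have MS : (1 - eta) * ((k ^ 5)%:R / S%:R) <= ((k ^ 5 - k) %/ S)%:R.
  by near: k; apply: near_scale_step => //; lra.
rewrite divr1 divn1 in M1.
have kR : 0 < k%:R :> R by rewrite ltr0n.
have k2R : 0 < k%:R ^+ 2 :> R by rewrite exprn_gt0.
have N0R : 0 < (k ^ d)%:R :> R by rewrite ltr0n expn_gt0 k0.
set L := scale_len c d k in T1 W1.
have L2E : scale_len (c / 2) d k = L / 2 by rewrite /L /scale_len; ring.
rewrite L2E in T2 W2.
have L0 : 0 < L by exact: scale_len_gt0.
have L20 : 0 < L / 2 by rewrite divr_gt0.
have L1 : L <= 1.
  clear -W1 L0 eta16 k0.
  have : 1 * L <= (k ^ 5)%:R * L 
    by apply: ler_wpM2r; [exact: ltW|rewrite ler1n expn_gt0 k0].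
  lra.
have [Lh Lh0 Lh1] : [/\ 0 + L / 2 <= 1, 0 <= 1 - L / 2 & 1 - L / 2 + L / 2 <= 1].
  by clear -L1 L0; split; lra.
have NL : (k ^ d)%:R * L = c * (d%:R * lnk k) by exact: scale_mulN.
have BW := scale_pointsE k d7.
pose W := (k ^ 5)%N; pose M0 := (k ^ 5 - k)%N; pose B := (k ^ (d - 5))%N.
have M0W : (M0 <= W)%N by exact: leq_subr.
have gapE : (W - M0)%N = k by exact: scale_gapE.
rewrite -gapE in T1 T2.
have B0 : (0 < B * W)%N by rewrite /B /W BW expn_gt0 k0.
pose near0 u := unhit (bQ A W) (block_hit A W 0 (0 + L / 2) S (M0 %/ S)) B u.
pose near1 u :=
  unhit (bQ A W) (block_hit A W (1 - L / 2) (1 - L / 2 + L / 2) S (M0 %/ S)) B u.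
pose some u := @some_miss R A W M0 S B L S u.
(* [near0] and [near1] catch the arcs around 0. As 0 is a fixed point of all the
   maps, the points must be subsampled for them. *)
exists (bP A W B), (fun u => some u || (near0 u || near1 u)); split.
- exact: bP_gt0.
- apply: le_trans (avg_or_le _ _ _) _.
  have e2 : expR (- ((1 - 8 * eta) * (c * (d%:R * lnk k)) / S%:R)) <=
      (k%:R ^+ 3)^-1.
    apply: expR_le_invXn => //; rewrite lerN2 ler_pdivlMr ?ltr0n//.
    have -> : (1 - 8 * eta) * (c * (d%:R * lnk k)) =
      ((1 - 8 * eta) * c) * (d%:R * lnk k) by ring.
    apply: (@le_trans _ _ (d%:R * lnk k)).
      by rewrite mulrAC ler_wpM2r// (le_trans _ dS)// ler_wpM2r// ler_nat.
    by apply: ler_peMl.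
  have k3 : (k%:R ^+ 3)^-1 = (k%:R ^+ 2)^-1 / k%:R :> R.
    by rewrite exprSr invfM.
  have kinv : (k%:R ^+ 2)^-1 / k%:R <= (k%:R ^+ 2)^-1 :> R.
    by rewrite ler_pdivrMr// ler_peMr ?invr_ge0 ?ltW// ltr1n.
  have i2 : 0 <= (k%:R ^+ 2)^-1 :> R by rewrite invr_ge0 ltW.
  have H1 : avg (bP A W B) (fun u => (some u)%:R) <= 2 / k%:R ^+ 2 :> R.
    apply: le_trans (avg_some_miss_le A_gt0 A_dvd A_double M0W L0 eta16 T1 W1 S0
      Seta B0 SS S0 M1 MS) _.
    rewrite [(B * W)%N]BW NL.
    have -> : 2 / k%:R ^+ 2 = (k%:R ^+ 2)^-1 + k%:R * (k%:R ^+ 3)^-1 :> R.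
      by rewrite k3; field; rewrite gt_eqF.
    apply: lerD.
      rewrite (expR_ln_nat _ d k0) -expRD; apply: expR_le_invXn => //.
      have -> : d%:R * lnk k - (1 - 8 * eta) * (c * (d%:R * lnk k)) =
        - (((1 - 8 * eta) * c - 1) * d%:R * lnk k) by ring.
      rewrite lerN2 ler_wpM2r//.
      apply: (@le_trans _ _ (eps / 2 * d%:R)); last by rewrite ler_wpM2r.
      by rewrite mulrAC [eps * _]mulrC ler_pdivlMr// -natrM.
    rewrite -mulrA in e2; apply: ler_pM; rewrite ?expR_ge0//.
      do 2 apply: mulr_ge0 => //.
      by rewrite addr_ge0// mulr_ge0// mulr_ge0// ltW.
    apply: (le_trans _ poly).
    have -> : S.+1%:R * (S%:R * (3 * c * d%:R + 1)) * lnk k =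
      S.+1%:R * (S%:R * (3 * (c * (d%:R * lnk k)) + lnk k)) by ring.
    by do 2 (apply: ler_wpM2l => //); rewrite lerD2l.
  have End al : 0 <= al -> al + L / 2 <= 1 ->
      avg (bP A W B) (fun u =>
        (unhit (bQ A W) (block_hit A W al (al + L / 2) S (M0 %/ S)) B u)%:R)
      <= (k%:R ^+ 2)^-1 :> R.
    move=> al0 al1; apply: le_trans (unhit_avg_le A_gt0 A_dvd A_double M0W L20 eta16
      T2 W2 S0 Seta B al0 al1 S0 _ MS (or_intror SS)) _.
      by rewrite mulnC leq_trunc_div.
    apply: expR_le_invXn => //; rewrite [(B * W)%N]BW lerN2.
    have -> : (k ^ d)%:R * (L / 2) = c * (d%:R * lnk k) / 2 by rewrite mulrA NL.
    have -> : (1 - 8 * eta) * (c * (d%:R * lnk k) / 2 / S%:R) =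
      ((1 - 8 * eta) * c) * (d%:R * lnk k) / 2 / S%:R by ring.
    rewrite ler_pdivlMr ?ltr0n// ler_pdivlMr//.
    apply: (@le_trans _ _ (d%:R * lnk k)).
      have -> : 2 * lnk k * S%:R * 2 = (4 * S%:R) * lnk k by ring.
      by rewrite ler_wpM2r.
    by apply: ler_peMl.
  have H2 : avg (bP A W B) (fun u => (near0 u || near1 u)%:R) <=
      2 / k%:R ^+ 2 :> R.
    apply: le_trans (avg_or_le _ _ _) _.
    have -> : 2 / k%:R ^+ 2 = (k%:R ^+ 2)^-1 + (k%:R ^+ 2)^-1 :> R.
      by rewrite mulr_natl mulr2n.
    exact: lerD (End 0 (lexx _) Lh) (End (1 - L / 2) Lh0 Lh1).
  have -> : 4 / k%:R ^+ 2 = 2 / k%:R ^+ 2 + 2 / k%:R ^+ 2 :> R.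
    by rewrite -mulrDl -natrD.
  exact: lerD.
move=> x; rewrite !negb_or => /and3P[/hasPn sx x0 x1].
have SM : (S * (M0 %/ S) <= M0)%N by rewrite mulnC leq_trunc_div.
have G : max_gap a (B * W) x <= L + 2 / (B * W)%:R + 2 * (2 ^ (W - M0))%:R^-1.
  apply: (max_gap_le_of_hits (A := A) L0) => //.
  - move=> i iN iL; have := sx i; rewrite mem_iota add0n => /(_ iN) /=.
    rewrite iL/=; set st := step _ _ _ _ => u1.
    have st0 : (0 < st)%N by rewrite /st /step; case: ifP.
    have [||n nN] := orbit_hit A_gt0 A_dvd A_double M0W _ _ u1 => //.
      by rewrite mulnC leq_trunc_div.
    by exists n.
  - have [n nN /andP[_ h]] := orbit_hit A_gt0 A_dvd A_double M0W SM S0 x0.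
    by exists n => //; move: h; rewrite add0r.
  - have [n nN /andP[h _]] := orbit_hit A_gt0 A_dvd A_double M0W SM S0 x1.
    by exists n.
rewrite [(B * W)%N]BW in G.
have lnN : ln (k ^ d)%:R = d%:R * lnk k by rewrite (expR_ln_nat _ d k0) expRK.
have dl0 : 0 < d%:R * lnk k by rewrite mulr_gt0// (lt_le_trans ltr01).
rewrite lnN ler_pdivrMr//.
apply: (upper_arith _ _ NL T1 G c3 _) => //.
rewrite mulrCA; apply: (@le_trans _ _ (eps * lnk k)).
  by rewrite mulrC -ler_pdivrMr.
by apply: ler_peMl; [rewrite mulr_ge0// ltW|rewrite ler1n; exact: (leq_trans _ d7)].
Unshelve. all: by end_near. Qed.

Lemma survivors_exponent_ge (K W N E1 X lk eta : R) :
    0 < W -> 0 < X -> 0 <= eta -> W * K <= N * E1 -> 8 * X * lk <= eta * K ->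
  2 * lk <= eta / W * (E1 * (N / (4 * X))).
Proof.
move=> W0 X0 eta0 h1 h2.
have -> : eta / W * (E1 * (N / (4 * X))) = eta * (N * E1) / (W * (4 * X)).
  by field; rewrite !gt_eqF.
rewrite ler_pdivlMr ?mulr_gt0//.
apply: le_trans (ler_wpM2l eta0 h1); have := ler_wpM2l (ltW W0) h2; lra.
Qed.

Lemma straddle_bound_le (k W B L tau X r : R) :
    0 < k -> 0 < L -> 0 <= B -> 0 <= tau -> W = k ^+ 5 -> B * W * L = X -> tau <= L ->
    4 * X <= k -> 0 <= r -> r <= k ->
  2 * (B * (k * (L + tau))) * r <= (k ^+ 2)^-1.
Proof.
move=> k0 L0 B0 t0 WE BX tL Xk r0 rk.
apply: (@le_trans _ _ (2 * (B * (k * (L + L))) * k)).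
  have h : k * (L + tau) <= k * (L + L) by rewrite ler_pM2l// lerD2l.
  have h0 : 0 <= k * (L + tau) by rewrite mulr_ge0 ?addr_ge0// ltW.
  apply: ler_pM => //; first by apply: mulr_ge0 => //; exact: mulr_ge0.
  by apply: ler_wpM2l => //; exact: ler_wpM2l.
have W0 : 0 < W by rewrite WE exprn_gt0.
have -> : 2 * (B * (k * (L + L))) * k = 4 * X * k ^+ 2 / W.
  by rewrite -BX; field; rewrite gt_eqF.
rewrite ler_pdivrMr// WE ler_pdivlMl ?exprn_gt0//.
have -> : k ^+ 5 = k ^+ 2 * (k * k ^+ 2) by ring.
by rewrite ler_pM2l ?exprn_gt0// ler_pM2r ?exprn_gt0.
Qed.

(** Among about [N / ln N] disjoint cells roughly [k ^ (d * eps)] are missed;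
    [d * eps >= 9] leaves room for the block length [k ^ 5] in the concentration
    bound, and [eta] is chosen after [d] so that [k ^ (41 * eta * d) <= k]. *)
Lemma lower_scale a eps : doubling_chain (fun n => a n.+1) ->
    0 < eps -> eps <= 1 / 2 ->
  exists2 d, (0 < d)%N & \forall k \near \oo, exists T (E : pred nat),
    [/\ (0 < T)%N, avg T (fun u => (E u)%:R) <= 4 / k%:R ^+ 2 :> R
      & forall x : circle R, ~~ E (digits T x) ->
          1 - 2 * eps <= (k ^ d)%:R * max_gap a (k ^ d) x / ln (k ^ d)%:R].
Proof.
set A := fun n : nat => a n.+1; move=> [A_gt0 A_dvd A_double] e0 e1.
pose d := (7 + (Num.truncn (9 / eps)).+1)%N.
have d7 : (7 <= d)%N by rewrite /d; lia.
have d0 : 0 < d%:R :> R by rewrite ltr0n; lia.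
have deps : 9 <= d%:R * eps.
  rewrite -ler_pdivrMr//; apply: (@le_trans _ _ (Num.truncn (9 / eps)).+1%:R).
    by rewrite ltW// truncnS_gt.
  by rewrite ler_nat /d; lia.
pose eta : R := (64 * d%:R)^-1.
have d64 : 0 < 64 * d%:R :> R by rewrite mulr_gt0.
have eta0 : 0 < eta by rewrite invr_gt0.
have etad : eta * d%:R = 1 / 64 by rewrite /eta; field; rewrite gt_eqF.
have d1 : 1 <= d%:R :> R by rewrite ler1n; exact: leq_trans d7.
have eta16 : eta <= 1 / 64.
  by rewrite -etad ler_peMr// ltW.
have etae : eta <= eps.
  rewrite -(ler_pM2r d0) etad [eps * _]mulrC; lra.
have eta16' : eta <= 1 / 16 by lra.
pose S := (Num.truncn (2 / eta)).+1.
have S0 : (0 < S)%N by [].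
have Seta : 2 / S%:R <= eta.
  rewrite ler_pdivrMr ?ltr0n// mulrC -ler_pdivrMr//.
  by rewrite ltW// /S truncnS_gt.
pose c : R := 1 - eps.
have c0 : 0 < c by rewrite /c; lra.
have c1 : c <= 1 by rewrite /c; lra.
have cd : (1 + 32 * eta) * c * d%:R <= d%:R - 8.
  have -> : (1 + 32 * eta) * c * d%:R = d%:R - d%:R * eps + 32 * c * (eta * d%:R).
    by rewrite /c; ring.
  rewrite etad; lra.
have cd' : 41 * eta * c * d%:R <= 1.
  have -> : 41 * eta * c * d%:R = 41 * c * (eta * d%:R) by ring.
  rewrite etad; lra.
exists d; first exact: leq_trans d7.
near=> k.
have k1 : (1 < k)%N by near: k; exact: nbhs_infty_gt.
have k0 : (0 < k)%N by exact: ltnW.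
have l1 : 1 <= lnk k by near: k; exact: near_ln_ge.
have l0 : 0 <= lnk k by apply: le_trans l1.
have dl_gt0 : 0 < d%:R * lnk k by rewrite mulr_gt0// (lt_le_trans ltr01).
have p0 : 1 * lnk k <= k%:R by near: k; exact: near_ln_le.
have p1 : (8 * c * d%:R / eta) * lnk k <= k%:R by near: k; exact: near_ln_le.
have p2 : (4 * c * d%:R) * lnk k <= k%:R by near: k; exact: near_ln_le.
have T1 : (2 ^ k)%:R^-1 <= eta * scale_len c d k by near: k; exact: near_scale_tau.
have W1 : (k ^ 5)%:R * scale_len c d k <= eta by near: k; exact: near_scale_block.
have M1 : (1 - eta) * ((k ^ 5)%:R / 1%:R) <= ((k ^ 5 - k) %/ 1)%:R.
  by near: k; apply: near_scale_step => //; lra.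
have Ls : 1 + S.+1%:R * (S%:R * 4) <= (2 * scale_len c d k)^-1.
  by near: k; exact: near_scale_small.
have WN : (k ^ 5)%:R <= eta * (k ^ d)%:R by near: k; exact: near_scale_count.
rewrite divr1 divn1 in M1.
have kR : 0 < k%:R :> R by rewrite ltr0n.
have kR1 : 1 <= k%:R :> R by rewrite ler1n.
have N0R : 0 < (k ^ d)%:R :> R by rewrite ltr0n expn_gt0 k0.
set L := scale_len c d k in T1 W1 Ls.
have L0 : 0 < L by exact: scale_len_gt0.
pose X := c * (d%:R * lnk k).
have X0 : 0 < X by rewrite mulr_gt0.
have NL : (k ^ d)%:R * L = X by exact: scale_mulN.
have LE : (4 * L)^-1 = (k ^ d)%:R / (4 * X).
  by rewrite -NL; field; rewrite !gt_eqF.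
have BW := scale_pointsE k d7.
pose W := (k ^ 5)%N; pose M0 := (k ^ 5 - k)%N; pose B := (k ^ (d - 5))%N.
have W0 : (0 < W)%N by rewrite expn_gt0 k0.
have M0W : (M0 <= W)%N by exact: leq_subr.
have gapE : (W - M0)%N = k by exact: scale_gapE.
have T1' := T1; rewrite -gapE in T1.
exists (bP A W B.+1), (no_survivor A W M0 S B L); split.
- exact: bP_gt0.
- have WN' : W%:R <= eta * (B * W)%:R by rewrite [(B * W)%N]BW.
  apply: le_trans (avg_no_survivor_le A_gt0 A_dvd A_double M0W L0 eta16' T1 W1 S0
    Seta W0 Ls WN' M1 eta0) _.
  rewrite [(B * W)%N]BW NL gapE LE.
  apply: (@le_trans _ _ ((k%:R ^+ 2)^-1 + (k%:R ^+ 2)^-1)); last first.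
    have : 0 <= (k%:R ^+ 2)^-1 :> R by rewrite invr_ge0 exprn_ge0.
    by move: ((k%:R ^+ 2)^-1 : R) => i; clear; lra.
  apply: lerD.
    apply: expR_le_invXn => //; rewrite lerN2.
    apply: (@survivors_exponent_ge (k%:R ^+ 3)) => //.
    + by rewrite ltr0n.
    + exact: ltW.
    + rewrite -natrX !(expR_ln_nat _ _ k0) -!expRD ler_expR.
      have -> : d%:R * lnk k - (1 + 32 * eta) * X =
        (d%:R - (1 + 32 * eta) * c * d%:R) * lnk k by rewrite /X; ring.
      by rewrite -mulrDl ler_wpM2r// lerBrDr; move: (cd); clear; lra.
    + have q1 : 8 * X <= eta * k%:R.
        move: (ler_wpM2l (ltW eta0) p1).
        have -> : eta * (8 * c * d%:R / eta * lnk k) = 8 * X.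
          by rewrite /X; field; rewrite gt_eqF.
        by [].
      apply: (@le_trans _ _ (eta * k%:R * k%:R)).
        by apply: ler_pM => //; [rewrite mulr_ge0// ltW|rewrite -[lnk k]mul1r].
      rewrite -mulrA ler_pM2l// [leRHS]exprS ler_pM2l// expr2.
      by rewrite ler_peMl.
  apply: (@straddle_bound_le k%:R W%:R B%:R L _ X) => //.
  + by rewrite natrX.
  + by rewrite -natrM [(B * W)%N]BW.
  + by apply: (le_trans T1'); rewrite ler_piMl ?ltW//; move: (eta16); clear; lra.
  + by move: (p2); rewrite /X; have -> : 4 * c * d%:R * lnk k =
      4 * (c * (d%:R * lnk k)) by ring.
  rewrite -expRN -expRD; apply: (@le_trans _ _ (expR (lnk k))).
    rewrite ler_expR.
    have -> : - ((1 - 9 * eta) * X) + - - ((1 + 32 * eta) * X) =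
      (41 * eta * c * d%:R) * lnk k by rewrite /X; ring.
    exact: ler_piMl.
  by rewrite lnK.
move=> x nx.
have G := max_gap_ge_of_survivor A_gt0 A_dvd A_double M0W L0 eta16' T1
  (a := a) (fun=> erefl) W0 nx.
rewrite [(B * W)%N]BW gapE in G.
have lnN : ln (k ^ d)%:R = d%:R * lnk k by rewrite (expR_ln_nat _ d k0) expRK.
rewrite lnN ler_pdivlMr//.
apply: (@le_trans _ _ ((1 - eta) * X)).
  have -> : (1 - eta) * X = ((1 - eta) * c) * (d%:R * lnk k) by rewrite /X; ring.
  rewrite ler_pM2r// /c.
  move: (etae) (e0) (eta0); clear => h1 h2 h3.
  have : 0 <= eta * eps by rewrite mulr_ge0// ltW.
  lra.
have -> : (1 - eta) * X = (k ^ d)%:R * (L - eta * L) by rewrite -NL; ring.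
rewrite ler_pM2l//; apply: le_trans G.
by rewrite lerD2l lerN2.
Unshelve. all: by end_near. Qed.

End Scales.

(** * From the scales [k ^ d] to all [N] *)

Section Conclusion.
Variable R : realType.
Implicit Types (a : nat -> nat) (eps : R) (d k : nat).

Lemma sum_invsq_le m :
  \sum_(0 <= n < m) (if n is 0 then 0 else 4 / n%:R ^+ 2) <= 8 :> R.
Proof.
pose g n : R := if n is 0 then 0 else 4 / n%:R ^+ 2.
have H j : \sum_(0 <= n < j.+2) g n <= 8 - 4 / j.+1%:R.
  elim: j => [|j IH]; first by rewrite !big_nat_recr//= big_geq// expr1n; lra.
  rewrite big_nat_recr//=; apply: le_trans (lerD IH (lexx _)) _.
  rewrite -addrA lerD2l /g -lerBrDl opprK -[j.+2%:R]natr1.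
  set x := j.+1%:R; have x0 : 0 < x :> R by rewrite ltr0n.
  have -> : - (4 / (x + 1)) + 4 / x = 4 / (x * (x + 1)).
    by field; rewrite !gt_eqF// addr_gt0.
  rewrite ler_pM2l// lef_pV2 ?posrE ?mulr_gt0 ?exprn_gt0 ?addr_gt0//.
  by rewrite expr2 ler_pM2r ?addr_gt0//; lra.
rewrite -/g; case: m => [|[|m]]; first by rewrite big_geq.
  by rewrite big_nat1.
by apply: le_trans (H m) _; rewrite gerBl divr_ge0.
Qed.

(** Borel-Cantelli; the scales [k ^ d] are so sparse that negative powers of their
    size are summable. *)
Lemma ae_eventually (Pk : nat -> circle R -> Prop) :
    (\forall k \near \oo, exists T (E : pred nat),
      [/\ (0 < T)%N, avg T (fun u => (E u)%:R) <= 4 / k%:R ^+ 2 :> R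
        & forall x, ~~ E (digits T x) -> Pk k x]) ->
  {ae @circle_measure R, forall x, \forall k \near \oo, Pk k x}.
Proof.
move=> [n0 _ H].
pose g n : R := if n is 0 then 0 else 4 / n%:R ^+ 2.
have /choice[F HF] : forall k, exists F : set (circle R),
    [/\ measurable F, (circle_measure F <= (g k)%:E)%E
      & (n0 < k)%N -> forall x, ~ F x -> Pk k x].
  move=> k; have [kn|kn] := ltnP n0 k; last first.
    exists set0; split => //; rewrite measure0 lee_fin /g.
    by case: k {kn} => // k; rewrite divr_ge0// exprn_ge0.
  have [T [E [T0 avgE HE]]] := H k (ltnW kn).
  have [mE muE] := digits_event R E T0.
  exists [set x | E (digits T x)]; split => //.
    apply: (le_trans muE); rewrite lee_fin /g.
    by case: k kn avgE {HE}.
  by move=> _ x Ex; apply: HE; apply/negP.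
have mF k : measurable (F k) by case: (HF k).
exists (lim_sup_set F); split.
- by apply: bigcap_measurable => // k _; apply: bigcup_measurable => ? _.
- apply: lim_sup_set_cvg0 => //.
  apply: (@le_lt_trans _ _ (8%:E)); last exact: ltry.
  apply: lime_le; first exact: is_cvg_nneseries.
  apply: nearW => n; apply: (@le_trans _ _ (\sum_(0 <= k < n) (g k)%:E)%E).
    by apply: lee_sum => k _; case: (HF k).
  by rewrite sumEFin lee_fin sum_invsq_le.
move=> x /= nP; apply: contrapT => nF; apply: nP.
have [n nFn] : exists n, ~ (\bigcup_(j in [set j | (n <= j)%N]) F j) x.
  by apply/existsNP => h; apply: nF => n _; exact: h.
exists (maxn n n0.+1) => // k /= nk.
have [_ _] := HF k; apply; first by rewrite (leq_trans _ nk)// leq_maxr.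
by move=> Fk; apply: nFn; exists k => //=; rewrite (leq_trans _ nk)// leq_maxl.
Qed.

Lemma near_root d (Q : nat -> Prop) : (0 < d)%N ->
    (\forall k \near \oo, forall N, (k ^ d <= N < k.+1 ^ d)%N -> Q N) ->
  \forall N \near \oo, Q N.
Proof.
move=> d0 [n0 _ H]; exists (n0 ^ d)%N => // N /= nN.
have ex0 : exists k, (k ^ d <= N)%N by exists n0.
have ub k : (k ^ d <= N)%N -> (k <= N)%N.
  apply: leq_trans; case: k => // k.
  by rewrite -{1}[k.+1]expn1 leq_pexp2l.
have [k kN kmax] := ex_maxnP ex0 ub.
apply: (H k); first exact: kmax.
rewrite kN /= ltnNge; apply/negP => /kmax; by rewrite ltnn.
Qed.

(** From Bernoulli's inequality for [(1 - 1 / (k + 1)) ^ d]. *)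
Lemma near_pow_ratio d eps : 0 < eps ->
  \forall k \near \oo, (1 - eps) * (k.+1 ^ d)%:R <= (k ^ d)%:R.
Proof.
move=> e0; near=> k.
have ke : d%:R / eps <= k%:R by near: k; exact: nbhs_infty_ger.
have k1 : 0 < k.+1%:R :> R by rewrite ltr0n.
have bern (z : R) n : 0 <= z -> z <= 1 -> 1 - n%:R * z <= (1 - z) ^+ n.
  move=> z0 z1; elim: n => [|n IH]; first by rewrite mul0r subr0 expr0.
  rewrite exprS -natr1.
  have : (1 - z) * (1 - n%:R * z) <= (1 - z) * (1 - z) ^+ n.
    by rewrite ler_wpM2l//; lra.
  apply: le_trans; have : 0 <= n%:R * (z * z) by rewrite !mulr_ge0.
  lra.
have z1 : k.+1%:R^-1 <= 1 :> R by rewrite invf_le1// ler1n.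
have z0 : 0 <= k.+1%:R^-1 :> R by rewrite invr_ge0 ltW.
have := bern _ d z0 z1.
have -> : 1 - k.+1%:R^-1 = k%:R / k.+1%:R :> R.
  by rewrite -natr1; field; rewrite natr1 gt_eqF.
rewrite expr_div_n ler_pdivlMr ?exprn_gt0// -!natrX; apply: le_trans.
rewrite ler_wpM2r// lerD2l lerN2 ler_pdivrMr//.
move: ke; rewrite ler_pdivrMr// mulrC => /le_trans; apply.
by rewrite ler_pM2l// ler_nat.
Unshelve. all: by end_near. Qed.

Lemma max_gap_ge0 a N (x : circle R) : 0 <= max_gap a N x.
Proof.
rewrite -[X in X <= _](subrr (0 : R)); apply: max_gap_ge => // n _ /andP[h1].
by rewrite ltNge h1.
Qed.

(** [max_gap] decreases with [N] and consecutive [d]-th powers have ratio tending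
    to 1, so that bounds at the scales [k ^ d] extend to all [N]. *)
Lemma near_upper_interp a x d eps : (0 < d)%N -> 0 < eps -> eps <= 1 / 2 ->
    (\forall k \near \oo,
      (k ^ d)%:R * max_gap a (k ^ d) x / ln (k ^ d)%:R <= 1 + 2 * eps) ->
  \forall N \near \oo, N%:R * max_gap a N x / ln (N%:R : R) <= 1 + 6 * eps.
Proof.
move=> d0 e0 e1 H; apply: (near_root d0); near=> k => N /andP[kN Nk].
have k1 : (1 < k)%N by near: k; exact: nbhs_infty_gt.
have Hk : (k ^ d)%:R * max_gap a (k ^ d) x / ln (k ^ d)%:R <= 1 + 2 * eps.
  by near: k.
have r : (1 - eps) * (k.+1 ^ d)%:R <= (k ^ d)%:R by near: k; exact: near_pow_ratio.
have kd1 : (1 < k ^ d)%N by rewrite -{1}(expn0 k) ltn_exp2l.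
have lk : 0 < ln (k ^ d)%:R :> R by rewrite ln_gt0// ltr1n.
have lN : ln (k ^ d)%:R <= ln N%:R :> R.
  by rewrite ler_ln ?posrE ?ltr0n ?ler_nat//; lia.
have lN0 : 0 < ln N%:R :> R by exact: lt_le_trans lN.
have GN := max_gap_nonincr a x kN.
have G0 := max_gap_ge0 a N x; have G0' := max_gap_ge0 a (k ^ d) x.
have NR : (1 - eps) * N%:R <= (k ^ d)%:R.
  by apply: le_trans r; rewrite ler_wpM2l//; [lra|rewrite ler_nat ltnW].
rewrite ler_pdivrMr// in Hk; rewrite ler_pdivrMr//.
have h1 : (1 - eps) * (N%:R * max_gap a N x) <= (1 + 2 * eps) * ln N%:R.
  apply: (@le_trans _ _ ((k ^ d)%:R * max_gap a (k ^ d) x)).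
    by rewrite mulrA ler_pM// mulr_ge0//; lra.
  by apply: (le_trans Hk); rewrite ler_wpM2l//; lra.
have h2 : 1 + 2 * eps <= (1 - eps) * (1 + 6 * eps).
  have : 0 <= eps * (1 / 2 - eps) by rewrite mulr_ge0//; lra.
  lra.
have e2 : 0 < 1 - eps by lra.
rewrite -(ler_pM2l e2); apply: (le_trans h1); rewrite mulrA ler_wpM2r// ltW//.
Unshelve. all: by end_near. Qed.

Lemma near_lower_interp a x d eps : (0 < d)%N -> 0 < eps -> eps <= 1 / 2 ->
    (\forall k \near \oo,
      1 - 2 * eps <= (k ^ d)%:R * max_gap a (k ^ d) x / ln (k ^ d)%:R) ->
  \forall N \near \oo, 1 - 6 * eps <= N%:R * max_gap a N x / ln (N%:R : R).
Proof.
move=> d0 e0 e1 [n0 _ H]; apply: (near_root d0); near=> k => N /andP[kN Nk].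
have k1 : (1 < k)%N by near: k; exact: nbhs_infty_gt.
have kn : (n0 <= k)%N by near: k; exact: nbhs_infty_ge.
have Hk := H k.+1 (leqW kn); rewrite /= in Hk.
have r : (1 - eps) * (k.+1 ^ d)%:R <= (k ^ d)%:R by near: k; exact: near_pow_ratio.
have kd1 : (1 < k ^ d)%N by rewrite -{1}(expn0 k) ltn_exp2l.
have lN0 : 0 < ln N%:R :> R by rewrite ln_gt0// ltr1n; lia.
have lN : ln N%:R <= ln (k.+1 ^ d)%:R :> R.
  by rewrite ler_ln ?posrE ?ltr0n ?ler_nat//; lia.
have lk : 0 < ln (k.+1 ^ d)%:R :> R by exact: lt_le_trans lN.
have GN := max_gap_nonincr a x (ltnW Nk).
have G0 := max_gap_ge0 a N x; have G0' := max_gap_ge0 a (k.+1 ^ d) x.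
have NR : (1 - eps) * (k.+1 ^ d)%:R <= N%:R.
  by apply: (le_trans r); rewrite ler_nat.
rewrite ler_pdivlMr// in Hk; rewrite ler_pdivlMr//.
have e2 : 0 <= 1 - eps by lra.
have e3 : 0 <= 1 - 2 * eps by lra.
apply: (@le_trans _ _ ((1 - eps) * ((1 - 2 * eps) * ln N%:R))).
  rewrite mulrA ler_wpM2r ?ltW//.
  have : 0 <= eps * eps by rewrite mulr_ge0 ?ltW.
  lra.
apply: (@le_trans _ _ ((1 - eps) * ((k.+1 ^ d)%:R * max_gap a (k.+1 ^ d) x))).
  by rewrite ler_wpM2l//; apply: le_trans Hk; rewrite ler_wpM2l.
by rewrite mulrA ler_pM// mulr_ge0.
Unshelve. all: by end_near. Qed.

End Conclusion.

Theorem theorem1p2 (R : realType) (q : R) (a : nat -> nat)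
    (hq : 1 < q)
    (ha_pos : forall n : nat, (1 <= n)%N -> (0 < a n)%N)
    (ha_lac : forall n : nat, (1 <= n)%N -> q * (a n)%:R <= (a n.+1)%:R)
    (ha_dvd : forall n : nat, (1 <= n)%N -> (a n %| a n.+1)%N) :
  {ae @circle_measure R, forall x : circle R,
     (N%:R * max_gap a N x / ln (N%:R : R)) @[N --> \oo] --> (1 : R)}.
Proof.
have chain : doubling_chain (fun n => a n.+1).
  split => n; [exact: ha_pos|exact: ha_dvd|].
  (* an integer ratio larger than 1 is at least 2 *)
  have /dvdnP[s sE] := ha_dvd n.+1 isT; have := ha_lac n.+1 isT.
  have a0 : 0 < (a n.+1)%:R :> R by rewrite ltr0n ha_pos.
  rewrite sE natrM ler_pM2r// => qs.
  have : 1 < s%:R :> R by exact: lt_le_trans qs.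
  by rewrite ltr1n leq_mul2r => ->; rewrite orbT.
pose eps j : R := j.+2%:R^-1.
have eps0 j : 0 < eps j by rewrite invr_gt0 ltr0n.
have eps1 j : eps j <= 1 / 2 by rewrite div1r lef_pV2 ?posrE ?ltr0n// ler_nat.
have bounds j : {ae @circle_measure R, forall x, \forall N \near \oo,
    1 - 6 * eps j <= N%:R * max_gap a N x / ln (N%:R : R) <= 1 + 6 * eps j}.
  have e1 : eps j <= 1 by have := eps1 j; lra.
  have [d d0 /ae_eventually U] := upper_scale chain (eps0 j) e1.
  have [d' d'0 /ae_eventually L] := lower_scale chain (eps0 j) (eps1 j).
  apply: filterS2 U L => x Ux Lx.
  have := near_upper_interp d0 (eps0 j) (eps1 j) Ux.
  have := near_lower_interp d'0 (eps0 j) (eps1 j) Lx.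
  by apply: filterS2 => N -> ->.
have /ae_foralln : forall j, {ae @circle_measure R, forall x, \forall N \near \oo,
    1 - 6 * eps j <= N%:R * max_gap a N x / ln (N%:R : R) <= 1 + 6 * eps j} by [].
apply: filterS => x Hx; apply/cvgrPdist_le => e e0.
pose j := Num.truncn (6 / e).
have je : 6 * eps j <= e.
  rewrite /eps ler_pdivrMr// mulrC -ler_pdivrMr//.
  by apply/ltW/(lt_trans (truncnS_gt _)); rewrite ltr_nat.
apply: filterS (Hx j) => N /andP[h1 h2].
by rewrite distrC ler_distl; apply/andP; split; lra.
Qed.
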